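(* Let $I\subset S$ be a monomial ideal generated in a single degree with $\dim S/I=0$. Suppose that $I$ has linear relations. Then $$\lim_{k\to\infty}\frac{\beta_i(S/I^k)}{\beta_1(S/I^k)}=\frac{k_i}{k_1}=\binom{n-1}{i-1}\qquad\text{for } i=1,\dots,n.$$
   Context: Let $S$ be either a regular local ring with maximal ideal $\mathfrak m$ and residue class field $K$, or a polynomial ring over a field $K$ in finitely many variables with graded maximal ideal $\mathfrak m$; let $n=\dim S$. Let $x_1,\dots,x_n$ be a (fixed) regular system of parameters if $S$ is regular local, and the indeterminates if $S$ is a polynomial ring. All ideals $I$ considered are proper. A monomial is a product $x_1^{a_1}\cdots x_n^{a_n}$, of degree $a_1+\dots+a_n$; a monomial ideal is an ideal generated by monomials, and it is generated in a single degree if its minimal monomial generators $u_1,\dots,u_m$ all have the same degree $d$. Such an ideal $I$ has linear relations if the kernel of the $S$-linear map $S^m\to I$, $e_j\mapsto u_j$, is generated by linear relations, i.e. by elements of the form $x_ae_p-x_be_q$ with $x_au_p=x_bu_q$ (in the polynomial ring case: the first syzygy module of $I$ is generated in degree $d+1$). Put $\beta_i(S/I^k)=\dim_K \mathrm{Tor}_i^S(S/\mathfrak m,S/I^k)$. By a theorem of Kodiyalam, for each $i\ge1$ there is a polynomial $\mathfrak P_i(I)$ (in one variable, with rational coefficients) with $\mathfrak P_i(I)(k)=\beta_i(S/I^k)$ for all $k\gg0$. For $i\ge1$ with $\mathfrak P_i(I)\ne0$, let $d_i=\deg\mathfrak P_i(I)$ and write the leading coefficient of $\mathfrak P_i(I)$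 as $k_i/d_i!$; this defines $k_i$. (Under the hypotheses of the claim, $\mathfrak P_i(I)\neq0$ for $i=1,\dots,n$.) *)

(* Defs.v *)
From HB Require Import structures.
From mathcomp Require Import all_boot all_order all_algebra.
From mathcomp Require Import ring_quotient.
From mathcomp Require Import all_classical reals topology normedtype sequences.
(* The notations of mpoly clash with those of MathComp-Analysis. *)
From mathcomp Require Import -(notations) mpoly.

Set Implicit Arguments.
Unset Strict Implicit.
Unset Printing Implicit Defensive.

Import Order.TTheory GRing.Theory Num.Theory.
Import numFieldNormedType.Exports.

Local Open Scope classical_set_scope.
Local Open Scope ring_scope.

(* As usual for [idealr_closed], ideals are proper ([1 \notin J]). *)
Definition is_ideal (S : comNzRingType) (J : set S) : Prop :=
  idealr_closed [in J].

Definition prime_ideal (S : comNzRingType) (J : set S) : Prop :=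
  is_ideal J /\ prime_idealr_closed [in J].

Definition maximal_ideal (S : comNzRingType) (M : set S) : Prop :=
  is_ideal M /\ forall J, is_ideal J -> M `<=` J -> J = M.

Definition gen_submod (S : comNzRingType) (V : lmodType S) (A : set V)
    : set V :=
  [set v | exists s : seq (S * V),
     (forall p, p \in s -> A p.2) /\ v = \sum_(p <- s) p.1 *: p.2].

(* May be the unit ideal, hence not always satisfies [is_ideal]. *)
Definition gen_ideal (S : comNzRingType) (A : set S) : set S :=
  @gen_submod S S^o A.

Definition ideal_exp (S : comNzRingType) (J : set S) (k : nat) : set S :=
  gen_ideal [set a | exists f : 'I_k -> S,
                       (forall j, J (f j)) /\ a = \prod_j f j].

Definition noetherian (S : comNzRingType) : Prop :=
  forall J : set S, is_ideal J ->
    exists (m : nat) (g : 'I_m -> S), J = gen_ideal (range g).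

(* [c 0 < c 1 < ... < c l] is a chain of primes containing J, that is, a chain
   of primes of S/J. *)
Definition prime_chain (S : comNzRingType) (J : set S) (l : nat)
    (c : nat -> set S) : Prop :=
  (forall j, (j <= l)%N -> prime_ideal (c j) /\ J `<=` c j) /\
  (forall j, (j < l)%N -> c j `<` c j.+1).

(* The Krull dimension of S/J is d; take [J = [set 0]] for that of S. *)
Definition krull_dim (S : comNzRingType) (J : set S) (d : nat) : Prop :=
  (exists c, prime_chain J d c) /\
  (forall l c, prime_chain J l c -> (l <= d)%N).

Definition rker (S : comNzRingType) (K : fieldType) (rho : {rmorphism S -> K})
    : set S :=
  [set a | rho a = 0].

(* S is a regular local ring of dimension n, with maximal ideal [rker rho],
   residue field K, residue map rho, and regular system of parameters x. *)
Definition regular_local (S : comNzRingType) (K : fieldType) (n : nat)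
    (x : 'I_n -> S) (rho : {rmorphism S -> K}) : Prop :=
  [/\ noetherian S,
      forall M : set S, maximal_ideal M <-> M = rker rho,
      forall b : K, exists a : S, rho a = b,
      krull_dim [set 0 : S] n
    & gen_ideal (range x) = rker rho].

(* S is, up to isomorphism, K[X_1, ..., X_n], with indeterminates x; rho takes
   a polynomial to its constant term, so that [rker rho] is the graded maximal
   ideal. *)
Definition polynomial_ring (S : comNzRingType) (K : fieldType) (n : nat)
    (x : 'I_n -> S) (rho : {rmorphism S -> K}) : Prop :=
  exists f : {rmorphism mpoly n K -> S},
    [/\ bijective f,
        forall i, f (mpolyX K (mnm1 i)) = x i
      & forall p, rho (f p) = mcoeff mnm0 p].

Definition monomial (S : comNzRingType) (n : nat) (x : 'I_n -> S)
    (a : multinom n) : S :=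
  \prod_(i < n) x i ^+ a i.

Definition minimal_monomial_generators (S : comNzRingType) (n : nat)
    (x : 'I_n -> S) (J : set S) (m : nat) (u : 'I_m -> multinom n) : Prop :=
  J = gen_ideal [set monomial x (u j) | j in [set: 'I_m]] /\
  forall j, ~ gen_ideal [set monomial x (u l) | l in [set l | l != j]]
                (monomial x (u j)).

(* Elements of S^m are row vectors, with e_p = [delta_mx 0 p]. *)
Definition linear_relations (S : comNzRingType) (n : nat) (x : 'I_n -> S)
    (m : nat) (u : 'I_m -> multinom n) : set 'rV[S]_m :=
  [set v | exists (a b : 'I_n) (p q : 'I_m),
     x a * monomial x (u p) = x b * monomial x (u q) /\
     v = x a *: delta_mx 0 p - x b *: delta_mx 0 q].

Definition has_linear_relations (S : comNzRingType) (n : nat) (x : 'I_n -> S)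
    (m : nat) (u : 'I_m -> multinom n) : Prop :=
  [set v : 'rV[S]_m | \sum_j v 0 j * monomial x (u j) = 0] =
  gen_submod (linear_relations x u).

(* A resolution of S/J by free modules F_i = S^(rk i) of finite rank, matrices
   acting on row vectors: [dif i] is F_(i+1) -> F_i, and [aug] lifts the
   augmentation F_0 -> S/J to a map F_0 -> S. *)
Record free_resolution (S : comNzRingType) (J : set S) := FreeResolution {
  rk : nat -> nat;
  dif : forall i, 'M[S]_(rk i.+1, rk i);
  aug : 'cV[S]_(rk 0);
  aug_surj : forall a : S, exists v : 'rV_(rk 0), J (a - (v *m aug) 0 0);
  aug_exact : forall v : 'rV_(rk 0),
    J ((v *m aug) 0 0) <-> exists w, v = w *m dif 0;
  dif_exact : forall i (v : 'rV_(rk i.+1)),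
    v *m dif i = 0 <-> exists w, v = w *m dif i.+1 }.

(* dim_K of the i-th homology of the complex of K-vector spaces F (x)_S K. *)
Definition tor_dim (S : comNzRingType) (K : fieldType)
    (rho : {rmorphism S -> K}) (J : set S) (F : free_resolution J) (i : nat)
    : nat :=
  match i with
  | 0 => (rk F 0 - \rank (map_mx rho (dif F 0)))%N
  | j.+1 => (\rank (kermx (map_mx rho (dif F j))) -
             \rank (map_mx rho (dif F j.+1)))%N
  end.

(* dim_K Tor_i^S(K, S/J), computed from any free resolution of S/J. *)
Definition betti (S : comNzRingType) (K : fieldType)
    (rho : {rmorphism S -> K}) (i : nat) (J : set S) : nat :=
  xget 0%N [set b | exists F : free_resolution J, tor_dim rho F i = b].

(* Junk value 0 if there is no such polynomial (there is one, by Kodiyalam's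
   theorem). *)
Definition kodiyalam_poly (S : comNzRingType) (K : fieldType)
    (rho : {rmorphism S -> K}) (J : set S) (i : nat) : {poly rat} :=
  xget 0 [set P : {poly rat} |
    \forall k \near \oo, P.[k%:R] = (betti rho i (ideal_exp J k))%:R].

(* The k_i such that the leading coefficient of P_i is k_i / d_i!, d_i being
   the degree of P_i. *)
Definition kodiyalam_coef (S : comNzRingType) (K : fieldType)
    (rho : {rmorphism S -> K}) (J : set S) (i : nat) : rat :=
  let P := kodiyalam_poly rho J i in
  lead_coef P * ((size P).-1)`!%:R.

(* Main.v *)
(* Write (l)^e for the e-th power of the ideal generated by a list l of the
   parameters.  If d is the generating degree then, in fact, I^k = m^(dk) as
   soon as k >= n, so that only the Betti numbers of powers of m matter.

   Equality of powers: since dim S/I = 0, I contains the x_i^d, and linearity of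
   the relations forces all x_i^c x_j^(d-c) into I.  Every monomial of degree dk
   is a product of k monomials of degree d in at most two variables each.

   Betti numbers of m^e: (z, l)^(e+1) = (l)^(e+1) + z (z, l)^e, and the two
   summands meet in z (l)^(e+1).  A mapping cone on the corresponding
   Mayer-Vietoris sequence is minimal, because the inclusion of (l)^(e+1) in
   (z, l)^e lifts to a map of resolutions with entries in m.  Pascal's rule then
   gives beta_(i+1)(S/m^e) = C(e+n-1, e+i) C(e+i-1, i), a polynomial in e of
   degree n-1.

   All that is used of S is that any set of the x_i generates a prime ideal
   which contains none of the other x_i.  For a regular local ring this follows
   from Krull's principal ideal theorem: a chain of n primes can be moved so that
   its second term contains x_1, and Nakayama's lemma makes the bottom prime
   zero. *)

Require Import Defs.
From HB Require Import structures.
From mathcomp Require Import all_boot all_order all_algebra.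
From mathcomp Require Import ring_quotient ring zify.
From mathcomp Require Import all_classical reals topology normedtype sequences.
From mathcomp Require Import -(notations) mpoly.

Set Implicit Arguments.
Unset Strict Implicit.
Unset Printing Implicit Defensive.

Import Order.TTheory GRing.Theory Num.Theory.
Import numFieldNormedType.Exports.

Local Open Scope classical_set_scope.
Local Open Scope ring_scope.

(** * Ideals and Noetherian rings *)

(** Unlike [is_ideal], the unit ideal is allowed, so sums, colons and saturations need no check of
    properness. *)
Definition idl (S : comNzRingType) (J : set S) : Prop :=
  J 0 /\ forall a u v, J u -> J v -> J (a * u + v).

Definition add1 (S : comNzRingType) (J : set S) (g : S) : set S :=
  [set a | exists b t, J b /\ a = b + t * g].

Definition primeI (S : comNzRingType) (J : set S) : Prop :=
  [/\ idl J, ~ J 1 & forall u v, J (u * v) -> J u \/ J v].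

Section Ideals.
Variable S : comNzRingType.
Implicit Types (J D E : set S) (a b g y : S).

Lemma idl0 J : idl J -> J 0. Proof. by case. Qed.

Lemma idlD J a b : idl J -> J a -> J b -> J (a + b).
Proof. by move=> [_ H] Ja Jb; rewrite -[a]mul1r; apply: H. Qed.

Lemma idlM J a b : idl J -> J b -> J (a * b).
Proof. by move=> [J0 H] Jb; rewrite -[a * b]addr0; apply: H. Qed.

Lemma idlMr J a b : idl J -> J a -> J (a * b).
Proof. by move=> HJ Ja; rewrite mulrC; apply: idlM. Qed.

Lemma idlN J a : idl J -> J a -> J (- a).
Proof. by move=> HJ Ja; rewrite -mulN1r; apply: idlM. Qed.

Lemma idlB J a b : idl J -> J a -> J b -> J (a - b).
Proof. by move=> HJ Ja Jb; apply: idlD => //; apply: idlN. Qed.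

Lemma idl_sum J (I : Type) (r : seq I) (P : pred I) (F : I -> S) :
  idl J -> (forall i, P i -> J (F i)) -> J (\sum_(i <- r | P i) F i).
Proof.
move=> HJ HF; apply: (big_ind (fun z => J z)) => //; first exact: idl0.
by move=> u v; apply: idlD.
Qed.

Lemma idl_zero : idl ([set 0] : set S).
Proof. by split=> // a u v /= -> ->; rewrite mulr0 addr0. Qed.

Lemma idl_colon J y : idl J -> idl [set a | J (a * y)].
Proof.
move=> HJ; split=> [|a u v] /=; first by rewrite mul0r; apply: idl0.
by move=> Ju Jv; rewrite mulrDl -mulrA; apply: HJ.2.
Qed.

Lemma idl_add1 J g : idl J -> idl (add1 J g).
Proof.
move=> HJ; split=> [|a u v].
  by exists 0, 0; split; [apply: idl0|rewrite mul0r addr0].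
move=> [b [t [Jb ->]]] [c [s [Jc ->]]].
exists (a * b + c), (a * t + s); split; first exact: HJ.2.
ring.
Qed.

Lemma sub_add1 J g : J `<=` add1 J g.
Proof. by move=> a Ja; exists a, 0; rewrite mul0r addr0. Qed.

Lemma mem_add1 J g : idl J -> add1 J g g.
Proof. by move=> HJ; exists 0, 1; rewrite mul1r add0r; split=> //; apply: idl0. Qed.

Lemma add1_min J E g : idl E -> J `<=` E -> E g -> add1 J g `<=` E.
Proof.
move=> HE JE Eg a [b [t [Jb ->]]]; apply: idlD => //; first exact: JE.
exact: idlM.
Qed.

Lemma add1_mono J E g : J `<=` E -> add1 J g `<=` add1 E g.
Proof. by move=> JE a [b [t [Jb ->]]]; exists b, t; split=> //; apply: JE. Qed.

Definition addl J (gs : seq S) : set S := foldr (fun g D => add1 D g) J gs.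

Lemma idl_addl J gs : idl J -> idl (addl J gs).
Proof. by move=> HJ; elim: gs => //= g gs; apply: idl_add1. Qed.

Lemma sub_addl J gs : J `<=` addl J gs.
Proof. by elim: gs => //= g gs IH a Ja; apply/sub_add1/IH. Qed.

Lemma mem_addl J gs g : idl J -> g \in gs -> addl J gs g.
Proof.
move=> HJ; elim: gs => //= h gs IH; rewrite inE => /orP[/eqP ->|/IH].
  by apply/mem_add1/idl_addl.
exact: sub_add1.
Qed.

Lemma addl_min J E gs :
  idl E -> J `<=` E -> (forall g, g \in gs -> E g) -> addl J gs `<=` E.
Proof.
move=> HE JE; elim: gs => //= h gs IH Eg; apply: add1_min => //.
  by apply: IH => g gg; apply: Eg; rewrite inE gg orbT.
by apply: Eg; rewrite inE eqxx.
Qed.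

Lemma addl_cons J g gs : idl J -> addl J (g :: gs) = addl (add1 J g) gs.
Proof.
move=> HJ; apply/seteqP; split.
  apply: addl_min; first exact/idl_addl/idl_add1.
    by move=> a Ja; apply/sub_addl/sub_add1.
  move=> h; rewrite inE => /orP[/eqP ->|hh].
    exact/sub_addl/mem_add1.
  by apply: mem_addl => //; apply: idl_add1.
apply: addl_min; first exact: (@idl_addl _ (g :: gs)).
  by apply: add1_mono; apply: sub_addl.
by move=> h hh; apply: mem_addl => //; rewrite inE hh orbT.
Qed.

Lemma addl_eq_mem J gs gs' : idl J -> gs =i gs' -> addl J gs = addl J gs'.
Proof.
move=> HJ e; apply/seteqP; split; apply: addl_min; try exact: idl_addl;
  try exact: sub_addl; move=> g; rewrite ?e => gg; apply: mem_addl => //.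
by rewrite e.
Qed.

Lemma is_idealP J : is_ideal J <-> idl J /\ ~ J 1.
Proof.
split=> [[J0 J1 JD]|[[J0 JD] J1]].
  split; last by move=> /mem_set; apply/negP.
  split; first by rewrite in_setE in J0.
  by move=> a u v Ju Jv; have := JD a u v; rewrite !in_setE; apply.
split; first exact: mem_set.
  by apply/negP; rewrite in_setE.
by move=> a u v; rewrite !in_setE; apply: JD.
Qed.

Lemma prime_idealP J : prime_ideal J <-> primeI J.
Proof.
split=> [[/is_idealP[HJ J1] H]|[HJ J1 H]].
  split=> // u v Juv; have /orP := H u v (mem_set Juv).
  by rewrite !in_setE.
split; first exact/is_idealP.
by move=> u v; rewrite in_setE => /H H'; apply/orP; rewrite !in_setE.
Qed.

Lemma primeI_exp J a k : primeI J -> J (a ^+ k) -> J a.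
Proof.
move=> [_ J1 JM]; elim: k => [|k IH]; first by rewrite expr0 => /J1.
by rewrite exprS => /JM[].
Qed.

Lemma gen_idealD (A : set S) : idl (gen_ideal A).
Proof.
split; first by exists [::]; rewrite big_nil.
move=> a u v [s [As ->]] [r [Ar ->]].
exists ([seq (a * p.1, p.2) | p <- s] ++ r); split.
  move=> p; rewrite mem_cat => /orP[/mapP[q /As qs ->] //|]; exact: Ar.
rewrite big_cat big_map /= mulr_sumr; congr (_ + _).
by apply: eq_bigr => p _; apply: mulrA.
Qed.

Lemma sub_gen_ideal (A : set S) : A `<=` gen_ideal A.
Proof.
move=> a Aa; exists [:: (1, a)]; split; last by rewrite big_seq1 scale1r.
by move=> p; rewrite inE => /eqP ->.
Qed.

Lemma gen_ideal_min (A : set S) E : idl E -> A `<=` E -> gen_ideal A `<=` E.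
Proof.
move=> HE AE a [s [As ->]]; rewrite big_seq; apply: idl_sum => // p /As /AE.
exact: idlM.
Qed.

Lemma gen_range_addl m (g : 'I_m -> S) :
  gen_ideal (range g) = addl [set 0] (codom g).
Proof.
apply/seteqP; split.
  apply: gen_ideal_min; first exact/idl_addl/idl_zero.
  by move=> _ [i _ <-]; apply: mem_addl; [apply: idl_zero|apply: codom_f].
apply: addl_min; [exact: gen_idealD| |].
  by move=> _ ->; apply: (idl0 (gen_idealD _)).
by move=> _ /codomP[i ->]; apply: sub_gen_ideal; exists i.
Qed.

End Ideals.

Section Noetherian.
Variable S : comNzRingType.
Hypothesis noethS : noetherian S.
Implicit Types (J D E P Q : set S) (a b g y : S).

Lemma noeth_fg J : idl J -> exists gs : seq S, J = addl [set 0] gs.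
Proof.
move=> HJ; have [J1|J1] := pselect (J 1); last first.
  have [m [g ->]] := noethS ((is_idealP J).2 (conj HJ J1)).
  by exists (codom g); apply: gen_range_addl.
(* [noetherian] speaks of proper ideals only, so the unit ideal is treated apart. *)
exists [:: 1]; apply/seteqP; split=> a Ja /=.
  by exists 0, a; rewrite mulr1 add0r.
by rewrite -[a]mulr1; apply: idlM.
Qed.

(** The union of the chain is finitely generated, and its generators all lie in a single [C k]. *)
Lemma acc (C : nat -> set S) : (forall k, idl (C k)) ->
  (forall k, C k `<=` C k.+1) -> exists k, C k.+1 `<=` C k.
Proof.
move=> HC Cm.
have mono k l : (k <= l)%N -> C k `<=` C l.
  move=> /subnK <-; elim: (l - k)%N => //= j IH a /IH; rewrite addSn; exact: Cm.
pose U : set S := [set a | exists k, C k a].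
have HU : idl U.
  split; first by exists 0%N; apply: idl0.
  move=> a u v [k Cu] [l Cv]; exists (maxn k l).
  by apply: (HC _).2; [apply: mono Cu|apply: mono Cv]; rewrite ?leq_maxl ?leq_maxr.
have [gs eU] := noeth_fg HU.
have [k Hk] : exists k, forall g, g \in gs -> C k g.
  have : forall g, g \in gs -> U g.
    by rewrite eU => g gg; apply: mem_addl => //; apply: idl_zero.
  elim: gs {eU} => [|g gs IH] Ug; first by exists 0%N.
  have [k Hk] := IH (fun h hh => Ug h (mem_behead (hh : h \in behead (g :: gs)))).
  have [l Hl] := Ug g (mem_head _ _).
  exists (maxn k l) => h; rewrite inE => /orP[/eqP ->|/Hk].
    by apply: mono Hl; rewrite leq_maxr.
  by apply: mono; rewrite leq_maxl.
exists k; apply: (@subset_trans _ U); first by move=> a; exists k.+1.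
by rewrite eU; apply: addl_min => // a ->; apply: idl0.
Qed.

Lemma noeth_max (F : set (set S)) J0 : (forall J, F J -> idl J) -> F J0 ->
  exists J, [/\ F J, J0 `<=` J & forall D, F D -> J `<=` D -> D `<=` J].
Proof.
move=> FI F0; apply: contrapT => /forallNP H.
(* Without a maximal member above [J0], a strictly larger one could be chosen at every stage,
   against [acc]; the default [J] is then never taken. *)
pose nxt J := xget J [set D | [/\ F D, J `<=` D & ~ D `<=` J]].
have nxtP J : F J -> J0 `<=` J -> [/\ F (nxt J), J `<=` nxt J & ~ nxt J `<=` J].
  move=> FJ sJ; rewrite /nxt; case: xgetP => [D -> //|nD].
  case: (H J); split=> // D FD JD; apply: contrapT => DJ.
  exact: (nD D).
pose C k := iter k nxt J0.
have CP k : F (C k) /\ J0 `<=` C k.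
  elim: k => [|k [Fk sk]]; first by split.
  have [? h ?] := nxtP _ Fk sk; split=> //; exact: subset_trans sk h.
have [k] := @acc C (fun k => FI _ (CP k).1)
                 (fun k => let: And3 _ h _ := nxtP _ (CP k).1 (CP k).2 in h).
by case: (nxtP _ (CP k).1 (CP k).2).
Qed.

End Noetherian.

(** * Krull's principal ideal theorem *)

Section Saturation.
Variables (S : comNzRingType) (P : set S).
Hypothesis HP : primeI P.
Implicit Types (J D E C : set S) (a b g y s : S).

(** The contraction to S of the extension of [J] to the localization S_P. Saturated ideals stand for
    the ideals of S_P, which is never constructed. *)
Definition sat J : set S := [set a | exists s, ~ P s /\ J (s * a)].

Lemma sub_sat J : J `<=` sat J.
Proof. by move=> a Ja; exists 1; rewrite mul1r; case: HP. Qed.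

Lemma not_primeM s t : ~ P s -> ~ P t -> ~ P (s * t).
Proof. by case: HP => _ _ H Ps Pt /H[]. Qed.

Lemma idl_sat J : idl J -> idl (sat J).
Proof.
move=> HJ; split; first by apply: sub_sat; apply: idl0.
move=> a u v [s [Ps Js]] [t [Pt Jt]]; exists (s * t).
split; first exact: not_primeM.
have -> : s * t * (a * u + v) = (t * a) * (s * u) + s * (t * v) by ring.
by apply: idlD => //; apply: idlM.
Qed.

Lemma sat_sat J : sat (sat J) `<=` sat J.
Proof.
move=> a [s [Ps [t [Pt Jst]]]]; exists (t * s).
by rewrite -mulrA; split=> //; apply: not_primeM.
Qed.

Lemma sat_mono J D : J `<=` D -> sat J `<=` sat D.
Proof. by move=> JD a [s [Ps /JD Ds]]; exists s. Qed.

Lemma sat_cancel J s a : sat J `<=` J -> ~ P s -> J (s * a) -> J a.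
Proof. by move=> sJ Ps Jsa; apply: sJ; exists s. Qed.

(** Nakayama's lemma over S_P, for [C] locally inside [D + x C]. The generators of [C] are discarded
    one by one, each being locally in the ideal of [D] and the remaining ones. *)
Lemma nakayama C D x : noetherian S -> idl C -> idl D -> P x ->
  (forall a, C a -> exists s d c, [/\ ~ P s, D d, C c & s * a = d + x * c]) ->
  C `<=` sat D.
Proof.
move=> noethS HC HD Px H; have [gs eC] := noeth_fg noethS HC.
have Cgs : forall g, g \in gs -> C g.
  by move=> g gg; rewrite eC; apply: mem_addl => //; apply: idl_zero.
have : C `<=` sat (addl D gs).
  apply: (@subset_trans _ (addl D gs)); last exact: sub_sat.
  rewrite eC; apply: addl_min; first exact: idl_addl.
    by move=> _ ->; apply: idl0; apply: idl_addl.
  by move=> g; apply: mem_addl.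
elim: gs Cgs {eC} => //= g gs IH Cgs CD; apply: IH.
  by move=> h hh; apply: Cgs; rewrite inE hh orbT.
set E := addl D gs in CD *; have HE : idl E by apply: idl_addl.
have satEg : sat E g.
  have [s [d [c [Ps Dd Cc e]]]] := H g (Cgs g (mem_head _ _)).
  have [t [Pt [b [r [Eb e2]]]]] := CD c Cc.
  (* This coefficient of [g] is a unit of S_P: [x] lies in [P] and [t * s] does not. *)
  exists (t * s - x * r); split.
    move=> H1; have := not_primeM Pt Ps; apply.
    rewrite -[t * s](subrK (x * r)); case: (HP) => HI _ _.
    by apply: idlD => //; apply: idlMr.
  have -> : (t * s - x * r) * g = t * d + x * b.
    have -> : (t * s - x * r) * g = t * (s * g) - x * (r * g) by ring.
    by rewrite e mulrDr mulrCA e2; ring.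
  by apply: idlD => //; apply: idlM => //; apply: sub_addl.
apply: (subset_trans CD); apply: (@subset_trans _ (sat (sat E))); last exact: sat_sat.
by apply: sat_mono; apply: add1_min => //; [exact: idl_sat|exact: sub_sat].
Qed.

End Saturation.

Section PrincipalIdealTheorem.
Variables (S : comNzRingType) (noethS : noetherian S).
Implicit Types (J D E C : set S) (a b g y s : S).

(** A maximal colon ideal (J : y) with y outside J is prime: if u v y is in J and v y is not, then
    (J : v y) contains (J : y), so it equals it, and u belongs to it. *)
Lemma associated_prime J : idl J -> ~ J 1 ->
  exists y, ~ J y /\ primeI [set a | J (a * y)].
Proof.
move=> HJ J1.
pose F := [set D | exists y, ~ J y /\ D = [set a | J (a * y)]].
have [||_ [[y [Jy ->]] _ maxy]] := @noeth_max S noethS F [set a | J (a * 1)].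
- by move=> _ [y [_ ->]]; apply: idl_colon.
- by exists 1.
exists y; split=> //; split; first exact: idl_colon.
  by rewrite /= mul1r.
move=> u v /= Juv; have [|Jvy] := pselect (J (v * y)); [by right|left].
apply: (maxy [set a | J (a * (v * y))]); first by exists (v * y).
  by move=> a /= Jay; rewrite mulrCA; apply: idlM.
by rewrite /= mulrA.
Qed.

Section Minimal.
Variables (p0 P : set S) (x : S).
Hypotheses (HP : primeI P) (p0_idl : idl p0).
Hypothesis minP : forall q, primeI q -> p0 `<=` q -> q x -> q `<=` P -> P `<=` q.

(* The local ring of S/(p0 + x) at the minimal prime P is Artinian. *)
Lemma artinian_mod J : idl J -> sat P J `<=` J -> p0 `<=` J -> J x ->
  forall D : nat -> set S, (forall k, [/\ idl (D k), sat P (D k) `<=` D k,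
    D k.+1 `<=` D k & J `<=` D k]) -> exists k, D k `<=` D k.+1.
Proof.
(* Noetherian induction: take [J] maximal among the ideals that violate the chain condition. *)
pose good J := forall D : nat -> set S, (forall k, [/\ idl (D k),
  sat P (D k) `<=` D k, D k.+1 `<=` D k & J `<=` D k]) ->
  exists k, D k `<=` D k.+1.
pose F := [set J | [/\ idl J, sat P J `<=` J, p0 `<=` J, J x & ~ good J]].
move=> HJ sJ p0J Jx; apply: contrapT => nG.
have [|J' [[{}HJ {}sJ {}p0J {}Jx {}nG] _ maxJ]] := @noeth_max S noethS F J _ (And5 HJ sJ p0J Jx nG).
  by move=> ? [].
move: J' => {}J in HJ sJ p0J Jx nG maxJ *; apply: nG => D HD; apply: contrapT => nD.
have mono k l : (k <= l)%N -> D l `<=` D k.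
  move=> /subnK <-; elim: (l - k)%N => [//|j IH a].
  by rewrite addSn; case: (HD (j + k)%N) => _ _ h _ /h /IH.
have J1 : ~ J 1.
  move=> J1; apply: nD; exists 0%N => a _; case: (HD 1%N) => _ _ _; apply.
  by rewrite -[a]mulr1; apply: idlM.
(* The associated prime lies in [P] since [J] is saturated, hence equals [P] by minimality. So [P]
   kills [y] modulo [J], and J + (y) is locally a simple extension of [J]. *)
have [y [Jy qy]] := associated_prime HJ J1.
have yP : [set a | J (a * y)] `<=` P.
  by move=> s /= Js; apply: contrapT => Ps; apply/Jy/(sat_cancel sJ Ps).
have Py : P `<=` [set a | J (a * y)].
  by apply: minP => // [a /p0J Ja|]; apply: idlMr.
pose sadd D := sat P (add1 D y).
have Hsadd E : idl E -> idl (sadd E) by move=> ?; apply/idl_sat/idl_add1.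
have goodJ' : good (sadd J).
  apply: contrapT => ng; apply: Jy; apply: (maxJ (sadd J)).
  - split=> //; [exact: Hsadd|exact: sat_sat| |].
      by apply: (subset_trans p0J) => a Ja; apply/sub_sat/sub_add1.
    by apply/sub_sat => //; apply: sub_add1.
  - by move=> a Ja; apply/sub_sat/sub_add1.
  - by apply/sub_sat => //; apply: mem_add1.
(* If [y] is in every [D k], the chain lies above the larger ideal [sadd J], which is good.
   Otherwise the chain is compared, from [l] on, with its sums with (y). *)
have [Dy|/existsNP[l Dy]] := pselect (forall k, D k y).
  apply: nD; apply: goodJ' => k; have [h1 h2 h3 h4] := HD k; split=> //.
  apply: (@subset_trans _ (sat P (D k))) h2.
  by apply: sat_mono; apply: add1_min.
have [|k Hk] := goodJ' (fun k => sadd (D (l + k)%N)).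
  move=> k; have [h1 h2 h3 h4] := HD (l + k)%N; split.
  - exact: Hsadd.
  - exact: sat_sat.
  - by rewrite addnS; apply/sat_mono/add1_mono.
  - exact/sat_mono/add1_mono.
apply: nD; exists (l + k)%N => a Da.
have [h1 h2 h3 h4] := HD (l + k)%N; have [g1 g2 g3 g4] := HD (l + k).+1.
have [s [Ps [c [t [Dc e]]]]] : sadd (D (l + k.+1)%N) a.
  by apply: Hk; apply/sub_sat => //; apply: sub_add1.
rewrite addnS in Dc.
(* Either [t * y] falls into [J], or [t] is a local unit and [y] would lie in [D (l + k)]. *)
have [Pt|Pt] := pselect (P t).
  apply: (sat_cancel g2 Ps); rewrite e; apply: idlD => //.
  by apply/g4/Py.
case: Dy; apply: (mono _ (l + k)%N); first exact: leq_addr.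
apply: (sat_cancel h2 Pt).
have -> : t * y = s * a - c by rewrite e addrC addKr.
by apply: idlB => //; [apply: idlM|apply: h3].
Qed.

End Minimal.

(* If no such q existed then, for b in p1
   outside p0, the ideals C k = ((p0 + b^k) : x^oo), localized at p2, would
   stabilize modulo x, hence stabilize by Nakayama; so x^j would lie in p1. *)
Theorem krull_pit (p0 p1 p2 : set S) x :
  primeI p0 -> primeI p1 -> primeI p2 -> p0 `<` p1 -> p1 `<` p2 -> p2 x ->
  exists q, [/\ primeI q, p0 `<` q, q `<` p2 & q x].
Proof.
move=> H0 H1 H2 p01 p12 p2x; apply: contrapT => /forallNP nq.
have p1x : ~ p1 x by move=> ?; apply: (nq p1).
(* If there is no such prime, [p2] is minimal over p0 + (x), as [artinian_mod] requires. *)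
have minP q : primeI q -> p0 `<=` q -> q x -> q `<=` p2 -> p2 `<=` q.
  move=> Hq sq qx q2; apply: contrapT => nq2; apply: (nq q); split=> //.
  by split=> // q0; apply/p1x/p01.1/q0.
have [s01 n01] := p01; have [s12 n12] := p12.
have [I0 I1 I2] : [/\ idl p0, idl p1 & idl p2] by case: H0 H1 H2 => ? _ _ [? _ _] [].
have [b p1b p0b] : exists2 b, p1 b & ~ p0 b.
  by apply: contrapT => h; apply: n01 => b p1b; apply: contrapT => ?; apply: h; exists b.
have p0x j a : p0 (x ^+ j * a) -> p0 a.
  by case: (H0) => _ _ /[apply] [[/(primeI_exp H0)/s01|]].
pose C k : set S := [set a | exists s j, ~ p2 s /\ add1 p0 (b ^+ k) (s * x ^+ j * a)].
have CI k : idl (C k).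
  split; first by exists 1, 0%N; rewrite mulr0; split; [case: H2|apply: idl0; apply: idl_add1].
  move=> a u v [s [i [Ps Cu]]] [t [j [Pt Cv]]]; exists (s * t), (i + j)%N.
  split; first exact: not_primeM.
  have -> : s * t * x ^+ (i + j) * (a * u + v) =
    (t * x ^+ j * a) * (s * x ^+ i * u) + (s * x ^+ i) * (t * x ^+ j * v).
    by rewrite exprD; ring.
  by apply: idlD; [exact: idl_add1| |]; apply: idlM => //; apply: idl_add1.
have Csat k : sat p2 (C k) `<=` C k.
  move=> a [s [Ps [t [j [Pt h]]]]]; exists (t * s), j; split; first exact: not_primeM.
  by have -> : t * s * x ^+ j * a = t * x ^+ j * (s * a) by ring.
have Cx k a : C k (x * a) -> C k a.
  move=> [s [j [Ps h]]]; exists s, j.+1; split=> //.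
  by have -> : s * x ^+ j.+1 * a = s * x ^+ j * (x * a) by rewrite exprS; ring.
have Cm k : C k.+1 `<=` C k.
  move=> a [s [j [Ps [c [t [p0c e]]]]]]; exists s, j; split=> //.
  by exists c, (t * b); rewrite e exprS mulrA.
have p0C k : p0 `<=` C k.
  move=> a p0a; exists 1, 0%N; split; first by case: H2.
  by apply: sub_add1; apply: idlM.
pose D k := sat p2 (add1 (C k) x).
have [k Dk] : exists k, D k `<=` D k.+1.
  apply: (@artinian_mod p0 p2 x H2 minP (sat p2 (add1 p0 x))).
  - exact/idl_sat/idl_add1.
  - exact: sat_sat.
  - by move=> a h; apply/sub_sat => //; apply: sub_add1.
  - by apply/sub_sat => //; apply: mem_add1.
  move=> k; split; first exact/idl_sat/idl_add1.
  - exact: sat_sat.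
  - exact/sat_mono/add1_mono.
  - exact/sat_mono/add1_mono.
(* An element of [C k] is locally [c + t * x] with [c] in [C k.+1]. Then [x * t] is in [C k], hence
   so is [t] by [Cx]: this is the hypothesis of Nakayama's lemma. *)
have Ck : C k `<=` C k.+1.
  apply: (subset_trans _ (Csat k.+1)); apply: (nakayama H2 noethS (x := x)) => //.
  move=> a Ca; have [|s [Ps [c [t [Cc e]]]]] := Dk a.
    by apply/sub_sat => //; apply: sub_add1.
  exists s, c, t; split=> //; last by rewrite e (mulrC t).
  apply: Cx; have -> : x * t = s * a - c by rewrite e addrC addKr mulrC.
  by apply: idlB => //; [apply: idlM|apply: Cm].
have [|s [j [Ps [c [t [p0c e]]]]]] := Ck (b ^+ k).
  exists 1, 0%N; split; first by case: H2.
  by rewrite expr0 !mul1r; apply: mem_add1.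
(* Cancelling [b ^+ k], which is outside [p0], puts [s * x ^+ j] into [p1], although neither factor
   belongs there. *)
have : p0 (b ^+ k * (s * x ^+ j - t * b)).
  suff -> : b ^+ k * (s * x ^+ j - t * b) = c by [].
  have -> : b ^+ k * (s * x ^+ j - t * b) = s * x ^+ j * b ^+ k - t * b ^+ k.+1.
    by rewrite exprS; ring.
  by rewrite e addrK.
case: (H0) => _ _ /[apply] [[/(primeI_exp H0)//|/s01 h]].
have : p1 (s * x ^+ j).
  by rewrite -(subrK (t * b) (s * _)); apply: idlD => //; apply: idlM.
by case: (H1) => _ _ /[apply] [[/s12//|/(primeI_exp H1)]].
Qed.

End PrincipalIdealTheorem.

(** * Parameters generate primes *)

(** The empty list is included: S is a domain and no variable is zero. *)
Definition prime_vars (S : comNzRingType) (n : nat) (x : 'I_n -> S) : Prop :=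
  forall T : seq 'I_n, primeI (addl [set 0] (map x T)) /\
    forall i, i \notin T -> ~ addl [set 0] (map x T) (x i).

Section RegularLocal.
Variables (S : comNzRingType) (noethS : noetherian S).
Implicit Types (J D E C : set S) (a b g y s : S) (c : nat -> set S).

Definition chain l c : Prop :=
  (forall j, (j <= l)%N -> primeI (c j)) /\ forall j, (j < l)%N -> c j `<` c j.+1.

(** [krull_pit] replaces the prime just below the top by one containing [y]; the argument then
    continues downwards with that prime as the new top. *)
Lemma move_chain l c y : chain l.+1 c -> c l.+1 y ->
  exists e, [/\ chain l.+1 e, e 0%N = c 0%N, e l.+1 = c l.+1 & e 1%N y].
Proof.
elim: l c y => [|l IH] c y; first by exists c.
move=> [cp cs] cy.
have [||||||q [qp q1 q2 qy]] := @krull_pit S noethS (c l) (c l.+1) (c l.+2) y => //.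
- by apply: cp; lia.
- by apply: cp; lia.
- by apply: cp.
- by apply: cs; lia.
- by apply: cs.
have [||e [[ep es] e0 el e1]] := IH (fun j => if j == l.+1 then q else c j) y.
- split=> j jl; case: eqP => e; first exact: qp.
  + by apply: cp; lia.
  + lia.
  case: eqP => [e'|_]; last by apply: cs; lia.
  by have -> : j = l by lia.
- by rewrite eqxx.
rewrite eqxx in el; exists (fun j => if j == l.+2 then c l.+2 else e j); split=> //.
- split=> j jl; case: eqP => e'; first exact: cp.
  + by apply: ep; lia.
  + lia.
  case: eqP => [e''|ne]; last by apply: es; lia.
  by rewrite (_ : j = l.+1) ?el; last lia.
- by rewrite eqxx.
Qed.

Variable M : set S.
Hypothesis maxM : forall J, idl J -> ~ J 1 -> J `<=` M.

(** Regularity of S/J without quotient rings: [M] is generated modulo [J] by as many elements as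
    some chain of primes from above [J] to [M] has steps. *)
Definition parameters J (ys : seq S) : Prop :=
  M `<=` addl J ys /\
  exists c, [/\ chain (size ys) c, J `<=` c 0%N & c (size ys) = M].

Lemma parameters_step J y ys c : idl J -> M `<=` addl J (y :: ys) ->
    chain (size ys).+1 c -> J `<=` c 0%N -> c (size ys).+1 = M -> M y ->
  exists e, [/\ chain (size ys) e, add1 J y `<=` e 0%N, e (size ys) = M,
     c 0%N `<` e 0%N & M `<=` addl (add1 J y) ys].
Proof.
move=> HJ HM Hc Jc cM My.
have [|e [[ep es] e0 el ey]] := move_chain Hc (y := y); first by rewrite cM.
exists (fun j => e j.+1); split=> //.
- by split=> j jl; [apply: ep|apply: es].
- apply: add1_min => //; first by case: (ep 1%N).
  by apply: (subset_trans Jc); rewrite -e0; case: (es 0%N).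
- by rewrite el.
- by rewrite -e0; apply: es.
- by rewrite -addl_cons.
Qed.

(** Induction gives c 0 inside J + (y). Since y is not in the prime c 0, an element b + t y of c 0
    has t in c 0; thus c 0 lies in J + y c 0, and Nakayama's lemma applies. *)
Lemma chain_bottom J ys c : idl J -> (forall y, y \in ys -> M y) -> ~ M 1 ->
    M `<=` addl J ys ->
    chain (size ys) c -> J `<=` c 0%N -> c (size ys) = M -> c 0%N `<=` J.
Proof.
move=> + + M1; elim: ys J c => [|y ys IH] J c HJ Hys HM Hc Jc cM.
  by rewrite cM.
have My : M y by apply: Hys; rewrite mem_head.
have [e [He Je eM ce HM']] := parameters_step HJ HM Hc Jc cM My.
have eJ : e 0%N `<=` add1 J y.
  apply: IH => //; first exact: idl_add1.
  by move=> z zz; apply: Hys; rewrite inE zz orbT.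
have [HI c1 cp] : primeI (c 0%N) by apply: Hc.1.
have MP : primeI M by rewrite -cM; apply: Hc.1.
have cy : ~ c 0%N y.
  by move=> cy; apply: ce.2; apply: (subset_trans eJ); apply: add1_min.
(* Elements outside the unique maximal ideal are units, so saturation at [M] changes nothing. *)
have satJ : sat M J `<=` J.
  move=> a [s [Ms Js]]; have [t [b [Jb e1]]] : exists t b, J b /\ 1 = b + t * s.
    have : add1 J s 1.
      apply: contrapT => h; apply: Ms; apply: (maxM _ h); first exact: idl_add1.
      exact: mem_add1.
    by move=> [b [t [Jb e1]]]; exists t, b.
  rewrite -[a]mul1r e1 mulrDl -mulrA.
  by apply: idlD => //; [apply: idlMr|apply: idlM].
apply: (subset_trans _ satJ); apply: (nakayama MP noethS (x := y)) => //.
move=> a ca; have [b [t [Jb e1]]] : add1 J y a by apply/eJ/ce.1.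
exists 1, b, t; split=> //; last by rewrite mul1r e1 (mulrC t).
have : c 0%N (t * y).
  have -> : t * y = a - b by rewrite e1 addrC addKr.
  by apply: idlB => //; apply: Jc.
by move=> /cp[].
Qed.

(** The elements of [ys] are moved into [J] one at a time. At the end [chain_bottom] identifies [J]
    with the bottom prime of a chain; a next parameter inside [J] would contradict the strict growth
    of that bottom when it is adjoined. *)
Lemma parameters_prime J ys zs : idl J -> ~ M 1 ->
    (forall y, y \in ys ++ zs -> M y) -> parameters J (ys ++ zs) ->
  primeI (addl J ys) /\ forall z zs', zs = z :: zs' -> ~ addl J ys z.
Proof.
move=> + M1; elim: ys J => [|y ys IH] J HJ Hys [HM [c [Hc Jc cM]]].
  rewrite /= in Hc cM HM Hys *.
  have cJ : c 0%N = J by apply/seteqP; split=> //; apply: chain_bottom cM.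
  split=> [|z zs' ezs Jz]; first by rewrite -cJ; apply: Hc.1.
  rewrite ezs in HM Hc cM Hys.
  have Mz : M z by apply: Hys; rewrite mem_head.
  have [e [He Je eM ce HM']] := parameters_step HJ HM Hc Jc cM Mz.
  have eJ : e 0%N `<=` add1 J z.
    apply: (chain_bottom _ _ M1 _ He) => //; first exact: idl_add1.
    by move=> w ww; apply: Hys; rewrite inE ww orbT.
  by apply: ce.2; apply: (subset_trans eJ); rewrite cJ; apply: add1_min.
have My : M y by apply: Hys; rewrite mem_head.
have [e [He Je eM ce HM']] := parameters_step HJ HM Hc Jc cM My.
rewrite addl_cons //; apply: IH; first exact: idl_add1.
  by move=> w ww; apply: Hys; rewrite /= inE ww orbT.
by split=> //; exists e.
Qed.

End RegularLocal.

Lemma rker_prime (S : comNzRingType) (K : fieldType) (rho : {rmorphism S -> K}) :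
  primeI (rker rho).
Proof.
split; first split.
- exact: rmorph0.
- by move=> a u v; rewrite /rker /= rmorphD rmorphM => -> ->; rewrite mulr0 addr0.
- by rewrite /rker /= rmorph1; apply/eqP/oner_neq0.
- move=> u v; rewrite /rker /= rmorphM => /eqP; rewrite mulf_eq0.
  by move=> /orP[] /eqP; [left|right].
Qed.

Lemma regular_local_prime_vars (S : comNzRingType) (K : fieldType) (n : nat)
    (x : 'I_n -> S) (rho : {rmorphism S -> K}) :
  regular_local x rho -> prime_vars x.
Proof.
move=> [noethS locS _ [[c [cp cs]] dimS] xM] T; set M := rker rho in locS xM.
have [HM M1 _] : primeI M := rker_prime rho.
have maxM J : idl J -> ~ J 1 -> J `<=` M.
  move=> HJ J1; pose F := [set D : set S | idl D /\ ~ D 1].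
  have [|D [[HD D1] JD maxD]] := @noeth_max S noethS F J _ (conj HJ J1).
    by move=> ? [].
  apply: (subset_trans JD); suff -> : D = M by [].
  apply/locS; split; first exact/is_idealP.
  by move=> E /is_idealP HE DE; apply/seteqP; split=> //; apply: maxD.
have Hc : chain n c.
  by split=> // j jn; apply/prime_idealP; case: (cp j jn).
have cM : c n = M.
  have [cI c1 _] : primeI (c n) by apply: Hc.1.
  apply/seteqP; split; first exact: maxM.
  apply: contrapT => nM.
  (* A longest chain ends at [M], since otherwise [M] could be appended to it. *)
  have := dimS n.+1 (fun j => if j == n.+1 then M else c j).
  rewrite ltnn => h; apply: notF; apply: h; split=> j jn.
    case: eqP => e; last by apply: cp; lia.
    split; first exact/prime_idealP/rker_prime.
    by move=> _ ->; apply: idl0.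
  rewrite (_ : (j == n.+1) = false); last by apply/eqP; lia.
  case: eqP => e; last by apply: cs; lia.
  have -> : j = n by lia.
  by split=> //; apply: maxM.
have main ys zs : perm_eq (ys ++ zs) (enum 'I_n) ->
    primeI (addl [set 0] (map x ys)) /\
    forall i zs', zs = i :: zs' -> ~ addl [set 0] (map x ys) (x i).
  move=> pe.
  have [||||h1 h2] := @parameters_prime S noethS M maxM [set 0] (map x ys) (map x zs).
  - exact: idl_zero.
  - by [].
  - move=> y; rewrite -map_cat -xM => /mapP[i _ ->]; apply: sub_gen_ideal; by exists i.
  - have -> : map x ys ++ map x zs = map x (ys ++ zs) by rewrite map_cat.
    split.
      move=> a; rewrite -{1}xM gen_range_addl (@addl_eq_mem _ _ (codom x) (map x (ys ++ zs))) //.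
        exact: idl_zero.
      by move=> y; apply: eq_mem_map => i; rewrite (perm_mem pe).
    exists c; rewrite size_map (perm_size pe) size_enum_ord; split=> //.
    by move=> _ ->; apply: idl0; case: (Hc.1 0%N).
  by split=> // i zs' e; apply: (h2 (x i) (map x zs')); rewrite e.
(* [T] may contain repetitions; filtering the enumeration gives the same ideal and completes to a
   permutation of all the variables. *)
pose ys := [seq i <- enum 'I_n | i \in T]; pose zs := [seq i <- enum 'I_n | i \notin T].
have eT : addl [set 0] (map x T) = addl [set 0] (map x ys).
  apply: addl_eq_mem; first exact: idl_zero.
  by apply: eq_mem_map => i; rewrite mem_filter mem_enum andbT.
have pe : perm_eq (ys ++ zs) (enum 'I_n) by rewrite perm_filterC.
rewrite eT; split; first by have [] := main _ _ pe.
move=> i iT; have izs : i \in zs by rewrite mem_filter iT mem_enum.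
(* Any [i] outside [T] may be taken as the next parameter. *)
have [|_] := main ys (i :: rem i zs); last by apply.
by apply: perm_trans pe; rewrite perm_cat2l perm_sym perm_to_rem.
Qed.

(** The ideal is the kernel of the substitution of 0 for the variables in [T], whose values lie in a
    domain. *)
Lemma polynomial_ring_prime_vars (S : comNzRingType) (K : fieldType) (n : nat)
    (x : 'I_n -> S) (rho : {rmorphism S -> K}) :
  polynomial_ring x rho -> prime_vars x.
Proof.
move=> [f [[g fK gK] fX _]] T; set V := addl _ _.
have HV : idl V by apply/idl_addl/idl_zero.
pose t : n.-tuple (mpoly n K) :=
  [tuple if i \in T then 0 else mpolyX K (mnm1 i) | i < n].
have eqM a b a' b' : V (a - a') -> V (b - b') -> V (a * b - a' * b').
  move=> Va Vb; have -> : a * b - a' * b' = b * (a - a') + a' * (b - b') by ring.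
  by apply: idlD => //; apply: idlM.
have VX i : V (f (mpolyX K (mnm1 i)) - f (tnth t i)).
  rewrite tnth_mktuple; case: ifP => iT; last by rewrite subrr; apply: idl0.
  rewrite rmorph0 subr0 fX; apply: mem_addl; first exact: idl_zero.
  exact: map_f.
have Vsub p : V (f p - f (comp_mpoly t p)).
  elim/mpolyind: p => [|c m p _ _ IH].
    by rewrite comp_mpoly0 subrr; apply: idl0.
  rewrite comp_mpolyD comp_mpolyZ comp_mpolyX mpolyXE_id !rmorphD.
  rewrite opprD addrACA; apply: idlD => //.
  rewrite -!mul_mpolyC !rmorphM -mulrBr; apply: idlM => //.
  rewrite !rmorph_prod; apply: (big_ind2 (fun a b => V (a - b))).
  - by rewrite subrr; apply: idl0.
  - by move=> ? ? ? ?; apply: eqM.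
  move=> i _; rewrite !rmorphXn /=; elim: (m i) => [|k IHk].
    by rewrite !expr0 subrr; apply: idl0.
  by rewrite !exprS; apply: eqM.
have VE : V = [set a | comp_mpoly t (g a) = 0].
  apply/seteqP; split=> a; last first.
    by move=> /= ga; have := Vsub (g a); rewrite ga rmorph0 subr0 gK.
  have gD a1 a2 : g (a1 + a2) = g a1 + g a2 by rewrite -[LHS]fK -[RHS]fK rmorphD !gK.
  have gM a1 a2 : g (a1 * a2) = g a1 * g a2 by rewrite -[LHS]fK -[RHS]fK rmorphM !gK.
  have g0 : g 0 = 0 by rewrite -(rmorph0 f) fK.
  move: a; apply: addl_min; first split=> [|c u v] /=.
  - by rewrite g0 comp_mpoly0.
  - by move=> gu gv; rewrite gD gM comp_mpolyD rmorphM /= gu gv mulr0 addr0.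
  - by move=> _ ->; rewrite /= g0 comp_mpoly0.
  - move=> _ /mapP[i iT ->] /=; rewrite -fX fK comp_mpolyXU -tnth_nth tnth_mktuple.
    by rewrite iT.
split; first split=> //.
- rewrite VE /= -(rmorph1 f) fK comp_mpoly1; exact/eqP/oner_neq0.
- move=> u v; rewrite VE /=.
  have -> : g (u * v) = g u * g v by rewrite -[LHS]fK -[RHS]fK rmorphM !gK.
  by rewrite rmorphM /= => /eqP; rewrite mulf_eq0 => /orP[] /eqP; [left|right].
- move=> i iT; rewrite VE /= -fX fK comp_mpolyXU -tnth_nth tnth_mktuple (negPf iT).
  move/(congr1 (mcoeff (mnm1 i))); rewrite mcoeffXU eqxx mcoeff0.
  exact/eqP/oner_neq0.
Qed.

(** * Powers of ideals generated by parameters *)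

Section Powers.
Variable S : comNzRingType.
Implicit Types (B D E : set S) (a b y : S) (l : seq S).

(* [B + (l)^e] for [e > 0], by the recursion
   [(y, l)^(e+1) = (l)^(e+1) + y (y, l)^e]. *)
Fixpoint pw B l : nat -> set S :=
  match l with
  | [::] => fun e => if e is 0%N then setT else B
  | y :: l' => fix pwy e := match e with
      | 0 => setT
      | e'.+1 => [set a | exists b c, [/\ pw B l' e'.+1 b, pwy e' c & a = b + y * c]]
      end
  end.

Lemma pw0 B l : pw B l 0 = setT. Proof. by case: l. Qed.

Lemma idl_pw B l e : idl B -> idl (pw B l e).
Proof.
move=> HB; elim: l e => [|y l IHl]; first by case.
elim=> // e IHe; split.
  by exists 0, 0; split; [apply: idl0|apply: idl0|rewrite mulr0 addr0].
move=> a u v [b [c [hb hc ->]]] [b' [c' [hb' hc' ->]]].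
exists (a * b + b'), (a * c + c'); split; last by ring.
  exact: (IHl _).2.
exact: IHe.2.
Qed.

Lemma pw_base B l e : idl B -> B `<=` pw B l e.
Proof.
move=> HB; elim: l e => [|y l IHl]; first by case=> [|e] a.
elim=> [a //|e IHe a] Ba; exists a, 0; split; [exact: IHl|exact: (idl0 (idl_pw (y :: l) e HB))|].
by rewrite mulr0 addr0.
Qed.

Lemma pw_behead B y l e : idl B -> pw B l e `<=` pw B (y :: l) e.
Proof.
move=> HB; case: e => // e a Ha; exists a, 0; split=> //.
  exact: (idl0 (idl_pw (y :: l) e HB)).
by rewrite mulr0 addr0.
Qed.

Lemma pw_mul B y l e a : idl B -> pw B (y :: l) e a -> pw B (y :: l) e.+1 (y * a).
Proof.
by move=> HB ha; exists 0, a; split=> //; [apply: (idl0 (idl_pw l e.+1 HB))|rewrite add0r].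
Qed.

Lemma pw_sub B l e : idl B -> pw B l e.+1 `<=` pw B l e.
Proof.
move=> HB; elim: l e => [|y l IHl]; first by case=> [|e] a.
elim=> [a //|e IHe a] [b [c [hb hc ->]]]; exists b, c; split=> //.
  exact: IHl.
exact: IHe.
Qed.

Lemma pw_mono B D l e : B `<=` D -> pw B l e `<=` pw D l e.
Proof.
move=> BD; elim: l e => [|y l IHl]; first by case=> [|e] a //; apply: BD.
elim=> [a //|e IHe a] [b [c [hb hc ->]]]; exists b, c; split=> //.
  exact: IHl.
exact: IHe.
Qed.

Lemma pw_add1 B z l e : idl B -> pw (add1 B z) l e.+1 `<=` add1 (pw B l e.+1) z.
Proof.
move=> HB; elim: l e => [|y l IHl] e; first by [].
have HI e' : idl (add1 (pw B (y :: l) e') z) by apply/idl_add1/idl_pw.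
have Hl e' : add1 (pw B l e') z `<=` add1 (pw B (y :: l) e') z.
  exact/add1_mono/pw_behead.
elim: e => [|e IHe] a [b [c [/IHl/Hl hb hc ->]]]; apply: idlD => //.
  by apply: sub_add1; apply: pw_mul.
have [c' [t [hc' ->]]] := IHe _ hc.
rewrite mulrDr mulrA; exists (y * c'), (y * t); split=> //.
exact: pw_mul.
Qed.

End Powers.

Section Variables.
Variables (S : comNzRingType) (n : nat) (x : 'I_n -> S).
Implicit Types (E : set S) (l T : seq 'I_n) (a b y : S).

Let V T := addl [set 0] (map x T).

Let idlV T : idl (V T). Proof. exact/idl_addl/idl_zero. Qed.

(** Double induction on [l] and [e]. In the step, [b] is written as j' + t x_z with j' in the power
    of [l], and the claim for [b] is reduced to that for [t] and exponent [e]. *)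
Lemma pw_nzd l T i e b : prime_vars x -> uniq (i :: l) -> i \notin T ->
    (forall j, j \in l -> j \notin T) ->
  pw (V T) (map x l) e (x i * b) -> pw (V T) (map x l) e b.
Proof.
move=> pv; elim: l T i e b => [|z l IHl] T i e b.
  case: e => // e _ iT _ /=; have [[_ _ h] ni] := pv T.
  by move=> /h[/(ni i iT)|].
rewrite map_cons /= inE negb_or -andbA.
move=> /and4P[niz nil nzl ul] iT lT.
have nzT : z \notin T by apply: lT; rewrite mem_head.
have nlT j : j \in l -> j \notin T by move=> jl; apply: lT; rewrite inE jl orbT.
have HI (l' : seq S) e' : idl (pw (V T) l' e') by apply: idl_pw.
elim: e b => // e IHe b [j [c [hj hc eb]]].
(* Modulo x_z, this is the induction hypothesis for the shorter list over [z :: T]. *)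
have [j' [t [hj' ebt]]] : add1 (pw (V T) (map x l) e.+1) (x z) b.
  apply: pw_add1 => //; apply: (IHl (z :: T) i).
  - by rewrite /= nil ul.
  - by rewrite inE negb_or niz iT.
  - move=> k kl; rewrite inE negb_or nlT // andbT.
    by apply: contraNneq nzl => <-.
  rewrite eb; apply: idlD; first exact: idl_pw (idlV (z :: T)).
    by apply: pw_mono hj; apply: sub_add1.
  apply: pw_base => //; apply: idlMr => //.
  by apply: mem_addl; [exact: idl_zero|exact: mem_head].
(* The same hypothesis, with x_z now in the role of x_i, cancels x_z. *)
have h1 : pw (V T) (map x l) e.+1 (x i * t - c).
  apply: (IHl T z) => //; first by rewrite /= nzl.
  have -> : x z * (x i * t - c) = j - x i * j'.
    have -> : x z * (x i * t - c) = x i * (j' + t * x z) - x i * j' - x z * c by ring.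
    by rewrite -ebt eb; ring.
  by apply: idlB => //; apply: idlM.
have h2 : pw (V T) (x z :: map x l) e t.
  apply: IHe; rewrite -(subrK c (x i * t)); apply: (idlD (HI (x z :: map x l) e)) => //.
  exact: (pw_sub (idlV T) (pw_behead (x z) (idlV T) h1)).
by exists j', t; split=> //; rewrite ebt mulrC.
Qed.

Lemma mon_pw l (a : 'I_n -> nat) :
  pw [set 0] (map x l) (\sum_(i <- l) a i) (\prod_(i <- l) x i ^+ a i).
Proof.
have Z := idl_zero S.
elim: l => [|z l IHl]; first by rewrite big_nil.
rewrite !big_cons; elim: (a z) => [|k IHk]; first by rewrite mul1r add0n; apply: pw_behead.
by rewrite exprS -mulrA addSn; apply: pw_mul.
Qed.

Lemma pw_min l e E : uniq l -> idl E ->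
    (forall a : 'I_n -> nat, (\sum_(i <- l) a i = e)%N -> E (\prod_(i <- l) x i ^+ a i)) ->
  pw [set 0] (map x l) e `<=` E.
Proof.
elim: l e E => [|z l IHl] e E.
  case: e => [|e] _ HE H a; last by move=> ->; apply: idl0.
  move=> _; rewrite -[a]mulr1; apply: idlM => //.
  by have := H (fun=> 0%N); rewrite !big_nil; apply.
move=> /= /andP[nzl ul]; elim: e E => [|e IHe] E HE H a.
  move=> _; rewrite -[a]mulr1; apply: idlM => //.
  by have := H (fun=> 0%N); rewrite !big1 //; apply.
have lz j : j \in l -> (j == z) = false.
  by move=> jl; apply: contraNF nzl => /eqP <-.
move=> [b [c [hb hc ->]]]; apply: idlD => //.
  apply: (IHl e.+1 E) hb => // d ed.
  have := H (fun j => if j == z then 0%N else d j).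
  rewrite !big_cons eqxx add0n mul1r.
  rewrite [X in E X](eq_big_seq (fun i => x i ^+ d i)); last by move=> j /lz ->.
  by apply; rewrite -ed; apply: eq_big_seq => j /lz ->.
have : [set c | E (c * x z)] c.
  apply: (IHe [set c | E (c * x z)]) hc; first exact: idl_colon.
  move=> d ed /=; pose d' j := if j == z then (d z).+1 else d j.
  suff <- : \prod_(i <- z :: l) x i ^+ d' i = \prod_(i <- z :: l) x i ^+ d i * x z.
    apply: H; rewrite -ed !big_cons /d' eqxx addSn; congr (_ + _).+1.
    by apply: eq_big_seq => j /lz ->.
  rewrite !big_cons /d' eqxx exprS -mulrA mulrC; congr (_ * _ * _).
  by apply: eq_big_seq => j /lz ->.
by rewrite /= mulrC.
Qed.

Definition mpow e : set S := pw [set 0] (map x (enum 'I_n)) e.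

Lemma idl_mpow e : idl (mpow e). Proof. exact/idl_pw/idl_zero. Qed.

Lemma mem_mpow (a : multinom n) : mpow (mdeg a) (monomial x a).
Proof.
have := mon_pw (enum 'I_n) a; rewrite !big_enum /= mdegE.
by apply.
Qed.

Lemma mpow_min e E : idl E -> (forall a : multinom n, mdeg a = e -> E (monomial x a)) ->
  mpow e `<=` E.
Proof.
move=> HE H; apply: pw_min => //; first exact: enum_uniq.
move=> a; rewrite !big_enum /= => ea.
pose m : multinom n := Multinom [tuple a i | i < n].
have mE i : m i = a i by rewrite mnmE.
have := H m; rewrite mdegE /monomial.
under eq_bigr do rewrite mE.
under [X in E X]eq_bigr do rewrite mE.
by apply.
Qed.

Lemma monomialD (a b : multinom n) :
  monomial x (mnm_add a b) = monomial x a * monomial x b.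
Proof.
rewrite /monomial -big_split /=; apply: eq_bigr => i _.
by rewrite mnmDE exprD.
Qed.

Lemma mpowM e f a b : mpow e a -> mpow f b -> mpow (e + f) (a * b).
Proof.
move=> ha hb; suff : [set a | mpow (e + f) (a * b)] a by [].
move: a ha; apply: mpow_min; first exact/idl_colon/idl_mpow.
move=> a ea /=; suff : [set b | mpow (e + f) (b * monomial x a)] b by rewrite /= mulrC.
move: b hb; apply: mpow_min; first exact/idl_colon/idl_mpow.
by move=> b eb /=; rewrite -monomialD -eb addnC -ea -mdegD; apply: mem_mpow.
Qed.

End Variables.

(** * Minimal resolutions of powers of the maximal ideal *)

(** The ideal itself is resolved here, not its quotient. Exactness is kept apart in [resolves], so
    that ranks and matrices can first be defined by recursion. *)
Record res (S : comNzRingType) := Res {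
  rrk : nat -> nat;
  rdif : forall i, 'M[S]_(rrk i.+1, rrk i);
  raug : 'cV[S]_(rrk 0) }.

Section Resolutions.
Variable S : comNzRingType.
Implicit Types (A B C : res S) (J : set S) (z : S).

Definition resolves A J : Prop :=
  [/\ forall a, J a <-> exists v, v *m raug A = a%:M,
      rdif A 0 *m raug A = 0,
      forall i, rdif A i.+1 *m rdif A i = 0,
      forall v : 'rV_(rrk A 0), v *m raug A = 0 -> exists w, v = w *m rdif A 0
    & forall i (v : 'rV_(rrk A i.+1)), v *m rdif A i = 0 ->
        exists w, v = w *m rdif A i.+1].

Definition chain_map A B (phi : forall i, 'M[S]_(rrk A i, rrk B i)) : Prop :=
  phi 0%N *m raug B = raug A /\
  forall i, rdif A i *m phi i = phi i.+1 *m rdif B i.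

Let bmxE := (mul_row_block, mul_block_col, mulmx_block, mul_row_col, mul_col_row,
  mul_col_mx, mul_mx_row, mul0mx, mulmx0, mul1mx, mulmx1, addr0, add0r,
  mul_scalar_mx, mul_mx_scalar, mulNmx, mulmxN).

Let simp0 := (oppr0, row_mx0, col_mx0, addr0, add0r, add_row_mx, subrr).

(* The cone of [(z, - phi) : A -> A (+) B]. *)
Section Cone.
Variables (A B : res S) (phi : forall i, 'M[S]_(rrk A i, rrk B i)) (z : S).

Definition cone_rk i : nat :=
  match i with
  | 0 => rrk A 0 + rrk B 0
  | j.+1 => (rrk A j.+1 + rrk B j.+1) + rrk A j
  end.

Definition cone_dif i : 'M[S]_(cone_rk i.+1, cone_rk i) :=
  match i with
  | 0 => col_mx (block_mx (rdif A 0) 0 0 (rdif B 0)) (row_mx z%:M (- phi 0))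
  | j.+1 => block_mx (block_mx (rdif A j.+1) 0 0 (rdif B j.+1)) 0
                     (row_mx z%:M (- phi j.+1)) (- rdif A j)
  end.

Definition cone : res S :=
  Res cone_dif (col_mx (raug A) (z *: raug B) : 'cV_(cone_rk 0)).

(** Lifts the inclusion of JA + z JB in JB, hence [phi] on A, multiplication by [z] on B and 0 on
    the shifted summand. *)
Definition cone_map i : 'M[S]_(rrk cone i, rrk B i) :=
  match i with
  | 0 => col_mx (phi 0) z%:M
  | j.+1 => col_mx (col_mx (phi j.+1) z%:M) 0
  end.

Definition cone_inl i : 'M[S]_(rrk A i, rrk cone i) :=
  match i with
  | 0 => row_mx 1%:M 0
  | j.+1 => row_mx (row_mx 1%:M 0) 0
  end.

Hypothesis phiP : chain_map phi.

Lemma cone_mapP : chain_map cone_map.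
Proof.
have [p0 pS] := phiP; split=> [|[|i]] /=.
- by rewrite !bmxE p0.
- by rewrite !bmxE scalerN subrr pS.
- by rewrite !bmxE scalerN subrr pS.
Qed.

Lemma cone_inlP : chain_map cone_inl.
Proof. by split=> [|[|i]] /=; rewrite !bmxE. Qed.

Variables JA JB : set S.
Hypotheses (HA : resolves A JA) (HB : resolves B JB).
Hypothesis zJA : forall b, JA (z * b) -> JA b.
Hypothesis znzd : forall b, z * b = 0 -> b = 0.

(** The map (z, -1) from JA to the direct sum of JA and JB is injective with cokernel JA + z JB,
    because JA and z JB meet in z JA. The cone is that of a lift of this map. *)
Lemma cone_resolves :
  resolves cone [set a | exists b c, [/\ JA b, JB c & a = b + z * c]].
Proof.
have [p0 pS] := phiP; have [iA dA0 dA eA0 eA] := HA; have [iB dB0 dB eB0 eB] := HB.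
split=> /=.
- move=> a; split.
    move=> [b [c [/iA[v ev] /iB[w ew] ->]]]; exists (row_mx v w).
    by rewrite mul_row_col ev -scalemxAr ew scale_scalar_mx -raddfD.
  move=> [v]; rewrite -[v]hsubmxK mul_row_col -scalemxAr.
  set s := _ *m raug A; set t := _ *m raug B => e.
  exists (s 0 0), (t 0 0); split.
  + by apply/iA; eexists; rewrite -mx11_scalar.
  + by apply/iB; eexists; rewrite -mx11_scalar.
  by have := congr1 (fun M : 'M_1 => M 0 0) e; rewrite !mxE eqxx mulr1n.
- by rewrite !bmxE dA0 -!scalemxAr dB0 p0 scaler0 subrr !col_mx0.
- case=> [|i] /=; rewrite !bmxE ?dA ?dB pS ?scalerN.
    by rewrite !simp0.
  by rewrite /block_mx !simp0.
- move=> v; rewrite -[v]hsubmxK; move: (lsubmx v) (rsubmx v) => a b.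
  rewrite mul_row_col -scalemxAr => e.
  (* The augmentation of [b] becomes an element of JA after multiplication by [z], so it lies in JA
     itself and has a preimage in A. *)
  have [c' ec] : exists c', c' *m raug A = b *m raug B.
    have [c eb] : exists c, b *m raug B = c%:M.
      by exists ((b *m raug B) 0 0); apply: mx11_scalar.
    rewrite eb; apply/iA/zJA/iA; exists (- a).
    rewrite mulNmx -scale_scalar_mx -eb; apply/eqP.
    by rewrite eq_sym -subr_eq0 opprK addrC e.
  have [w ew] : exists w, b - c' *m phi 0 = w *m rdif B 0.
    by apply: eB0; rewrite mulmxBl -mulmxA p0 ec subrr.
  have [w' ew'] : exists w', a + z *: c' = w' *m rdif A 0.
    by apply: eA0; rewrite mulmxDl -scalemxAl ec.
  exists (row_mx (row_mx w' w) (- c')); rewrite !bmxE.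
  by rewrite -ew' -ew add_row_mx scalerN addrK opprK subrK.
(* Once the shifted component [c] is the boundary of [w], the corrections [a + z w] and [b - w phi]
   are cycles of A and B. *)
- have lift i (a : 'rV_(rrk A i.+1)) b c w : c = w *m rdif A i ->
      a *m rdif A i + z *: c = 0 -> b *m rdif B i - c *m phi i = 0 ->
      exists a' b', a = a' *m rdif A i.+1 - z *: w /\
                    b = b' *m rdif B i.+1 + w *m phi i.+1.
    move=> -> e1 e2.
    have [a' ea] : exists a', a + z *: w = a' *m rdif A i.+1.
      by apply: eA; rewrite mulmxDl -scalemxAl.
    have [b' eb] : exists b', b - w *m phi i.+1 = b' *m rdif B i.+1.
      by apply: eB; rewrite mulmxBl -mulmxA -pS mulmxA.
    by exists a', b'; rewrite -ea -eb addrK subrK.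
  case=> [|i] /= v; rewrite -[v]hsubmxK; move: (rsubmx v) => c;
    rewrite -[lsubmx v]hsubmxK; move: (lsubmx _) (rsubmx _) => a b; rewrite !bmxE.
  + rewrite add_row_mx -row_mx0 => /eq_row_mx[e1 e2].
    (* In lowest degree, [c] has augmentation 0 because [z] is a nonzerodivisor on S. *)
    have [w ew] : exists w, c = w *m rdif A 0.
      apply: eA0; rewrite [LHS]mx11_scalar (_ : _ 0 0 = 0) ?raddf0 //.
      apply: znzd; have := congr1 (fun M => (M *m raug A) 0 0) e1.
      by rewrite mulmxDl -mulmxA dA0 mulmx0 add0r mul0mx -scalemxAl !mxE.
    have [a' [b' [-> ->]]] := lift _ _ _ _ _ ew e1 e2.
    exists (row_mx (row_mx a' b') (- w)); rewrite !bmxE !add_row_mx.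
    by rewrite scalerN !opprK ew.
  + rewrite add_row_mx -!row_mx0 => /eq_row_mx[/eq_row_mx[e1 e2]] e3.
    have [w ew] : exists w, c = w *m rdif A i.+1.
      by apply: eA; apply/eqP; rewrite -oppr_eq0 e3.
    have [a' [b' [-> ->]]] := lift _ _ _ _ _ ew e1 e2.
    exists (row_mx (row_mx a' b') (- w)); rewrite !bmxE !add_row_mx.
    by rewrite scalerN !opprK ew.
Qed.

End Cone.
End Resolutions.

(* For [ladder_of l], [lres e] resolves [(l)^e] and [lmap e] lifts the inclusion
   of [(l)^(e+1)] in [(l)^e]. *)
Record ladder (S : comNzRingType) := Ladder {
  lres : nat -> res S;
  lmap : forall e i, 'M[S]_(rrk (lres e.+1) i, rrk (lres e) i) }.

Section Ladder.
Variable S : comNzRingType.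
Implicit Types (L : ladder S) (z : S) (l : seq S).

(** For the ladder of l, carries a lift of the inclusion of (l)^e in (z, l)^e along with the
    resolution. Composed with [lmap], it lifts that of (l)^(e+1) in (z, l)^e, whose cone is the next
    resolution. *)
Fixpoint ladder_step_aux L z e :
    {C : res S & forall i, 'M[S]_(rrk (lres L e) i, rrk C i)} :=
  match e with
  | 0 => existT _ (lres L 0) (fun i => 1%:M)
  | e'.+1 =>
    let phi i := lmap L e' i *m projT2 (ladder_step_aux L z e') i in
    existT _ (cone phi z) (cone_inl phi z)
  end.

Definition ladder_step L z : ladder S :=
  @Ladder S (fun e => projT1 (ladder_step_aux L z e))
    (fun e => cone_map (fun i => lmap L e i *m projT2 (ladder_step_aux L z e) i) z).

Definition ladder_base : ladder S :=
  @Ladder S (fun e => @Res S (fun i => (e == 0) && (i == 0) : nat)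
                         (fun i => 0) (const_mx 1))
            (fun e i => 0).

Fixpoint ladder_of l : ladder S :=
  if l is z :: l' then ladder_step (ladder_of l') z else ladder_base.

(** Ranks add up in a cone, and Pascal's rule sums them. Truncated predecessors give the right
    boundary values: for e = 0, rank 1 in degree 0 and 0 elsewhere; for [l] empty and e > 0, rank
    0. *)
Lemma ladder_rank l e i :
  rrk (lres (ladder_of l) e) i =
  ('C((e + size l).-1, e + i) * 'C((e + i).-1, i))%N.
Proof.
elim: l e i => [|z l IHl] e i /=.
  case: e => [|e]; case: i => [|i] //=; rewrite ?bin0n ?addn0 ?add0n //=.
  - by rewrite bin_small.
  - by rewrite bin_small //; lia.
elim: e i => [|e IHe] i /=.
  rewrite IHl !add0n; case: i => [|i]; first by rewrite !bin0.
  by rewrite !(bin_small (leqnn _)) !muln0.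
case: i => [|i] /=; rewrite !IHl IHe.
  rewrite !addn0 !bin0 !muln1 !addSn !addnS /= binS addnC.
  by case: e {IHe}.
rewrite ?addSn ?addnS /= ?addSn /= ['C((e + size l).+1, _)]binS.
rewrite !['C((e + i).+1, i.+1)]binS.
lia.
Qed.

Definition ladder_exact L l : Prop :=
  forall e, resolves (lres L e) (pw [set 0] l e) /\ chain_map (lmap L e).

Lemma ladder_base_exact : ladder_exact ladder_base [::].
Proof.
move=> e; split; last first.
  by split=> [|i] /=; [case: e => [|e]; apply/matrixP => -[]|rewrite mul0mx mulmx0].
split=> /=.
- move=> a; case: e => [|e] /=.
    split=> // _; exists a%:M; rewrite mul_scalar_mx; apply/matrixP => i j.
    by rewrite !mxE !ord1 mulr1.
  split=> [->|[v]]; first by exists 0; rewrite mul0mx raddf0.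
  by rewrite thinmx0 mul0mx => /matrixP/(_ 0 0); rewrite !mxE eqxx.
- by rewrite mul0mx.
- by move=> i; rewrite mul0mx.
- move=> v; case: e v => [|e] /= v e0; exists 0; rewrite mul0mx; last by rewrite thinmx0.
  move/matrixP: e0 => /(_ 0 0); rewrite !mxE big_ord1 mxE mulr1 => e0.
  by apply/matrixP => i j; rewrite !ord1 e0 mxE.
- by move=> i v _; exists 0; move: v; rewrite /= andbF => v; rewrite !thinmx0.
Qed.

Lemma ladder_step_exact L z l :
    (forall e b, pw [set 0] l e.+1 (z * b) -> pw [set 0] l e.+1 b) ->
    (forall b, z * b = 0 -> b = 0) ->
  ladder_exact L l -> ladder_exact (ladder_step L z) (z :: l).
Proof.
move=> zpw znzd HL.
have comp (A B C : res S) (f : forall i, 'M_(rrk A i, rrk B i))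
    (g : forall i, 'M_(rrk B i, rrk C i)) :
    chain_map f -> chain_map g -> chain_map (fun i => f i *m g i).
  move=> [f0 fS] [g0 gS]; split=> [|i]; first by rewrite -mulmxA g0.
  by rewrite mulmxA fS -mulmxA gS mulmxA.
have H e : resolves (lres (ladder_step L z) e) (pw [set 0] (z :: l) e) /\
    chain_map (projT2 (ladder_step_aux L z e)).
  elim: e => [|e [IHe IHe']] /=.
    split; last by split=> [|i]; rewrite ?mul1mx ?mulmx1.
    by have [] := HL 0%N; rewrite pw0.
  have phiP := comp _ _ _ _ _ (HL e).2 IHe'.
  split; last exact: cone_inlP.
  exact: (cone_resolves phiP (HL e.+1).1 IHe (zpw e) znzd).
by move=> e; split; [exact: (H e).1|apply/cone_mapP/comp/(H e).2/(HL e).2].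
Qed.

Lemma ladder_of_exact l :
    (forall z l1 l2 e b, l = l1 ++ z :: l2 ->
      pw [set 0] l2 e (z * b) -> pw [set 0] l2 e b) ->
    (forall z b, z \in l -> z * b = 0 -> b = 0) ->
  ladder_exact (ladder_of l) l.
Proof.
elim: l => [|z l IHl] H1 H2; first exact: ladder_base_exact.
apply: ladder_step_exact => [e b|b|].
- exact: (H1 z [::] l).
- exact/H2/mem_head.
- apply: IHl => [w l1 l2 e b el|w b wl]; last by apply: H2; rewrite inE wl orbT.
  by apply: (H1 w (z :: l1)); rewrite el.
Qed.

Variables (K : fieldType) (rho : {rmorphism S -> K}).

(** [raug] counts because it becomes the first differential for S/J, except at exponent 0, where it
    is not in m. [lmap] counts because it enters the next cone. *)
Definition ladder_minimal L : Prop := forall e,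
  [/\ map_mx rho (raug (lres L e.+1)) = 0,
      forall i, map_mx rho (rdif (lres L e) i) = 0
    & forall i, map_mx rho (lmap L e i) = 0].

(** A cone adds only [z] and [phi] to the differentials, and [phi] factors through [lmap]; the
    identity blocks of [cone_inl] never enter on their own. *)
Lemma ladder_of_minimal l : (forall z, z \in l -> rho z = 0) ->
  ladder_minimal (ladder_of l).
Proof.
elim: l => [|z l IHl] Hl.
  move=> e; split=> [|i|i] /=; rewrite ?raddf0 //.
  by apply/matrixP => -[].
have /IHl {}IHl w : w \in l -> rho w = 0 by move=> wl; apply: Hl; rewrite inE wl orbT.
have rz : rho z = 0 by apply/Hl/mem_head.
have rmap e i : map_mx rho (lmap (ladder_of l) e i *m
    projT2 (ladder_step_aux (ladder_of l) z e) i) = 0.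
  by rewrite map_mxM; have [_ _ ->] := IHl e; rewrite mul0mx.
have z0 k : map_mx rho (z%:M : 'M_k) = 0 by rewrite map_scalar_mx rz raddf0.
have simp0 := (map_col_mx, map_row_mx, map_block_mx, map_mxN, map_mxZ, rz, scale0r,
  rmap, z0, raddf0, oppr0, col_mx0, row_mx0).
have dif e i : map_mx rho (rdif (lres (ladder_of (z :: l)) e) i) = 0.
  elim: e i => [|e IHe] i; first by have [_ h _] := IHl 0%N; apply: h.
  have [_ hA _] := IHl e.+1.
  by case: i => [|i] /=; rewrite /block_mx !(hA, IHe, simp0).
move=> e; split=> [|i|i] /=; first by rewrite !simp0; have [-> _ _] := IHl e; rewrite simp0.
  exact: dif.
by case: i => [|i] /=; rewrite !simp0.
Qed.

End Ladder.

(** * Betti numbers *)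

Section Comparison.
Variables (S : comNzRingType) (J : set S).
Hypothesis HJ : idl J.
Implicit Types F G : free_resolution J.

Lemma rowwise p q r (M : 'M[S]_(p, q)) (N : 'M[S]_(r, q)) :
  (forall i, exists w, row i M = w *m N) -> exists X, M = X *m N.
Proof.
move=> /choice[w ew]; exists (\matrix_i w i); apply/row_matrixP => i.
by rewrite row_mul rowK.
Qed.

Lemma lift_aug F p (M : 'cV[S]_p) :
  exists X : 'M_(p, rk F 0), forall i, J ((M - X *m aug F) i 0).
Proof.
have /choice[w ew] : forall i, exists v : 'rV_(rk F 0), J (M i 0 - (v *m aug F) 0 0).
  by move=> i; apply: aug_surj.
exists (\matrix_i w i) => i; have := ew i.
have -> : w i *m aug F = row i (\matrix_i w i *m aug F) by rewrite row_mul rowK.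
by rewrite !mxE.
Qed.

Lemma lift0 F p (M : 'M[S]_(p, rk F 0)) :
  (forall i, J ((M *m aug F) i 0)) -> exists X, M = X *m dif F 0.
Proof.
move=> H; apply: rowwise => i; apply/(aug_exact (f := F)).
by rewrite -row_mul mxE; apply: H.
Qed.

Lemma liftS F k p (M : 'M[S]_(p, rk F k.+1)) :
  M *m dif F k = 0 -> exists X, M = X *m dif F k.+1.
Proof.
move=> H; apply: rowwise => i; apply/(dif_exact (f := F)).
by rewrite -row_mul H row0.
Qed.

Lemma dif_dif F k : dif F k.+1 *m dif F k = 0.
Proof.
apply/row_matrixP => i; rewrite row0 row_mul; apply/(dif_exact (f := F)).
by exists (delta_mx 0 i); rewrite rowE.
Qed.

Lemma dif_aug F p (X : 'M_(p, rk F 1)) i : J ((X *m dif F 0 *m aug F) i 0).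
Proof.
have : J ((row i X *m dif F 0 *m aug F) 0 0).
  by apply/(aug_exact (f := F)); exists (row i X).
by rewrite -!row_mul mxE.
Qed.

Lemma J_mulmx p q (X : 'M[S]_(p, q)) (M : 'cV[S]_q) i :
  (forall j, J (M j 0)) -> J ((X *m M) i 0).
Proof. by move=> H; rewrite mxE; apply: idl_sum => // j _; apply: idlM. Qed.

(** A lift of the identity of S/J, chosen degree by degree; by [compare0] and [compareS] the default
    0 does no harm. *)
Fixpoint compare F G k : 'M[S]_(rk F k, rk G k) :=
  match k with
  | 0 => xget 0 [set X | forall i, J ((aug F - X *m aug G) i 0)]
  | k'.+1 => xget 0 [set X | dif F k' *m compare F G k' = X *m dif G k']
  end.

Lemma compare0 F G i : J ((aug F - compare F G 0 *m aug G) i 0).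
Proof.
rewrite /=; case: xgetP => [X -> //|H].
by have [X HX] := lift_aug G (aug F); case: (H X).
Qed.

Lemma compareS F G k : dif F k *m compare F G k = compare F G k.+1 *m dif G k.
Proof.
have step : (exists X, dif F k *m compare F G k = X *m dif G k) ->
    dif F k *m compare F G k = compare F G k.+1 *m dif G k.
  by move=> [X HX] /=; case: xgetP => [Y -> //|/(_ X)].
apply: step; elim: k => [|k IH].
  apply: lift0 => i; have := @compare0 F G; set P := compare F G 0 => H.
  have -> : dif F 0 *m P *m aug G =
      dif F 0 *m aug F - dif F 0 *m (aug F - P *m aug G).
    by rewrite mulmxBr opprB addrC subrK mulmxA.
  rewrite !mxE; apply: idlB => //; last first.
    by have := J_mulmx (dif F 0) i H; rewrite mxE.
  by have := dif_aug (1%:M : 'M_(rk F 1)) i; rewrite mul1mx mxE.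
have e : dif F k *m compare F G k = compare F G k.+1 *m dif G k.
  by case: IH => X HX /=; case: xgetP => [Y -> //|/(_ X)].
by apply: liftS; rewrite -mulmxA -e mulmxA dif_dif mul0mx.
Qed.

(** The round trip minus the identity lifts the zero map of S/J, so it is null-homotopic; the [h]
    found in one degree serves as [h'] in the next. *)
Lemma compare_homotopy F G k : exists h h',
  compare F G k.+1 *m compare G F k.+1 - 1%:M =
  h *m dif F k.+1 + dif F k *m h'.
Proof.
pose t k := compare F G k *m compare G F k - 1%:M.
have tS j : t j.+1 *m dif F j = dif F j *m t j.
  rewrite /t mulmxBl mulmxBr mul1mx mulmx1 -mulmxA -compareS mulmxA -compareS.
  by rewrite mulmxA.
suff H : forall j, exists h h', t j.+1 = h *m dif F j.+1 + dif F j *m h' by apply: H.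
have next j (h' : 'M_(rk F j, rk F j.+1)) : dif F j *m t j = dif F j *m h' *m dif F j ->
    exists h, t j.+1 = h *m dif F j.+1 + dif F j *m h'.
  move=> e; have [|h eh] := @liftS F j _ (t j.+1 - dif F j *m h').
    by rewrite mulmxBl tS e subrr.
  by exists h; rewrite -eh subrK.
elim=> [|j [h [h' e]]].
  have [|h' e] := @lift0 F _ (t 0%N).
    move=> i; have -> : t 0%N *m aug F =
        - (aug F - compare F G 0 *m aug G) - compare F G 0 *m (aug G - compare G F 0 *m aug F).
      by rewrite /t mulmxBl mul1mx mulmxBr mulmxA !opprB [RHS]addrC addrA subrK.
    rewrite !mxE; apply: idlB => //.
      by apply: idlN => //; have := compare0 G i; rewrite !mxE.
    have := @J_mulmx _ _ (compare F G 0) (aug G - compare G F 0 *m aug F) i (@compare0 G F).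
    by rewrite mxE.
  have e0 : dif F 0 *m t 0 = dif F 0 *m h' *m dif F 0 by rewrite e mulmxA.
  have [h eh] := next 0%N h' e0.
  by exists h, h'.
have e1 : dif F j.+1 *m t j.+1 = dif F j.+1 *m h *m dif F j.+1.
  by rewrite e mulmxDr !mulmxA dif_dif mul0mx addr0.
by have [h1 eh] := next j.+1 h e1; exists h1, h.
Qed.

Variables (K : fieldType) (rho : {rmorphism S -> K}).

(** Up to homotopy the identity factors through the g-complex. So the cycles of f are spanned by
    boundaries and the image of a complement of the g-boundaries in the g-cycles. *)
Lemma homology_le p1 p0 p2 q1 q0 q2 (f0 : 'M[K]_(p1, p0)) (f1 : 'M_(p2, p1))
    (g0 : 'M[K]_(q1, q0)) (g1 : 'M_(q2, q1)) (a : 'M_(p1, q1)) (a0 : 'M_(p0, q0))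
    (b : 'M_(q1, p1)) (b2 : 'M_(q2, p2)) (h : 'M_(p1, p2)) (h' : 'M_(p0, p1)) :
    g1 *m g0 = 0 -> f0 *m a0 = a *m g0 -> g1 *m b = b2 *m f1 ->
    a *m b - 1%:M = h *m f1 + f0 *m h' ->
  (\rank (kermx f0) - \rank f1 <= \rank (kermx g0) - \rank g1)%N.
Proof.
move=> gg fa gb hh; set Z := kermx f0; set Z' := kermx g0.
have sBZ' : (g1 <= Z')%MS by apply/sub_kermxP.
have sZ : (Z <= (Z' :\: g1)%MS *m b + f1)%MS.
  have -> : Z = Z *m a *m b - Z *m h *m f1.
    have : Z *m (a *m b - 1%:M) = Z *m h *m f1.
      by rewrite hh mulmxDr !mulmxA mulmx_ker mul0mx addr0.
    by rewrite mulmxBr mulmx1 mulmxA => <-; rewrite subKr.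
  apply: addmx_sub; last by rewrite eqmx_opp; apply: submx_trans (submxMl _ _) (addsmxSr _ _).
  have sZa : (Z *m a <= Z')%MS by apply/sub_kermxP; rewrite -mulmxA -fa mulmxA mulmx_ker mul0mx.
  apply: submx_trans (submxMr b sZa) _.
  have -> : (Z' *m b :=: (Z' :\: g1)%MS *m b + g1 *m b)%MS.
    apply: eqmx_trans (addsmxMr _ _ _); apply: eqmxMr.
    apply: eqmx_trans (eqmx_sym (addsmx_diff_cap_eq Z' g1)) _.
    by apply: adds_eqmx => //; apply/capmx_idPr.
  by apply: addsmxS => //; rewrite gb submxMl.
have eZ' := mxrank_cap_compl Z' g1; rewrite (capmx_idPr sBZ') in eZ'.
have l1 := mxrankS sZ; have l2 := mxrank_adds_leqif ((Z' :\: g1)%MS *m b) f1.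
have l3 := mxrankM_maxl (Z' :\: g1)%MS b.
rewrite leq_subLR -eZ' addKn; apply: leq_trans l1 _; apply: leq_trans l2.1 _.
by rewrite addnC leq_add2l.
Qed.

Lemma tor_dim_le F G i : (tor_dim rho F i.+1 <= tor_dim rho G i.+1)%N.
Proof.
have [h [h' e]] := compare_homotopy F G i.
apply: (@homology_le _ _ _ _ _ _ _ _ _ _ (map_mx rho (compare F G i.+1))
   (map_mx rho (compare F G i)) (map_mx rho (compare G F i.+1))
   (map_mx rho (compare G F i.+2)) (map_mx rho h) (map_mx rho h')).
- by rewrite -map_mxM dif_dif map_mx0.
- by rewrite -!map_mxM compareS.
- by rewrite -!map_mxM compareS.
- by rewrite -!map_mxM -map_mxD -e map_mxB map_mx1.
Qed.

Lemma betti_tor_dim F i : betti rho i.+1 J = tor_dim rho F i.+1.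
Proof.
rewrite /betti; case: xgetP => [b -> [G <-]|/(_ (tor_dim rho F i.+1)) []].
  by apply/eqP; rewrite eqn_leq !tor_dim_le.
by exists F.
Qed.

End Comparison.

Section QuotientResolution.
Variables (S : comNzRingType) (J : set S) (A : res S) (HA : resolves A J).

(** Prepends S to a resolution of [J], which shifts degrees by one. *)
Definition quot_rk i : nat := if i is j.+1 then rrk A j else 1%N.

Definition quot_dif i : 'M[S]_(quot_rk i.+1, quot_rk i) :=
  match i with 0 => raug A | j.+1 => rdif A j end.

Lemma quot_surj (a : S) : exists v : 'rV_1, J (a - (v *m 1%:M : 'M_1) 0 0).
Proof.
exists a%:M; rewrite mulmx1 mxE eqxx mulr1n subrr.
by have [-> _ _ _ _] := HA; exists 0; rewrite mul0mx raddf0.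
Qed.

Lemma quot_exact0 (v : 'rV_1) :
  J ((v *m 1%:M : 'M_1) 0 0) <-> exists w, v = w *m quot_dif 0.
Proof.
rewrite mulmx1; have [-> _ _ _ _] := HA.
by split=> -[w]; rewrite -mx11_scalar => e; exists w.
Qed.

Lemma quot_exact i (v : 'rV_(quot_rk i.+1)) :
  v *m quot_dif i = 0 <-> exists w, v = w *m quot_dif i.+1.
Proof.
have [_ d0 dS e0 eS] := HA; case: i v => [|i] v.
  by split=> [/e0|[w ->]] //; rewrite -mulmxA d0 mulmx0.
by split=> [/eS|[w ->]] //; rewrite -mulmxA dS mulmx0.
Qed.

Definition quot_resolution : free_resolution J :=
  @FreeResolution S J quot_rk quot_dif 1%:M quot_surj quot_exact0 quot_exact.

End QuotientResolution.

Section BettiPower.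
Variables (S : comNzRingType) (K : fieldType) (n : nat) (x : 'I_n -> S).
Variable rho : {rmorphism S -> K}.
Hypotheses (xprime : prime_vars x) (rho_x : forall i, rho (x i) = 0).

(** All differentials vanish over K, so Betti numbers are ranks, shifted by one degree. *)
Lemma betti_mpow e i : (0 < e)%N ->
  betti rho i.+1 (mpow x e) = ('C((e + n).-1, e + i) * 'C((e + i).-1, i))%N.
Proof.
case: e => // e _; pose l := map x (enum 'I_n).
have ll : ladder_exact (ladder_of l) l.
  apply: ladder_of_exact => [z l1 l2 f b el|_ b /mapP[j _ ->] xb].
    have ul : uniq (enum 'I_n) := enum_uniq _.
    have := esym el => /(congr1 (drop (size l1))).
    rewrite drop_size_cat // -map_drop.
    case E : (drop (size l1) (enum 'I_n)) => [//|j l3] [-> ->].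
    have : uniq (j :: l3) by rewrite -E drop_uniq.
    by move=> u; apply: (@pw_nzd S n x l3 [::] j f b).
  have [[_ _ h] nx] := xprime [::].
  by have [/(nx j isT)|] := h (x j) b xb.
have lm := @ladder_of_minimal S K rho l _.
rewrite (betti_tor_dim _ _ (quot_resolution (ll e.+1).1)); last first.
  exact: idl_mpow.
have /lm {}lm : forall z, z \in l -> rho z = 0 by move=> _ /mapP[j _ ->].
have [ra _ _] := lm e; have [_ rd _] := lm e.+1.
rewrite /tor_dim.
have -> : map_mx rho (dif (quot_resolution (ll e.+1).1) i) = 0.
  by case: i => [|i] /=.
rewrite [map_mx _ _](rd i) mxrank0 subn0 kermx0 mxrank1 /=.
by rewrite ladder_rank size_map size_enum_ord.
Qed.

End BettiPower.

(** * Powers of linearly presented monomial ideals *)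

Section MonomialIdeal.
Variables (S : comNzRingType) (K : fieldType) (n : nat) (x : 'I_n -> S).
Variable rho : {rmorphism S -> K}.
Hypotheses (xprime : prime_vars x) (rho_x : forall i, rho (x i) = 0).

Let V (T : seq 'I_n) : set S := addl [set 0] (map x T).

Lemma mem_vars T i : i \in T -> V T (x i).
Proof. by move=> iT; apply: mem_addl; [exact: idl_zero|exact: map_f]. Qed.

Lemma monomial_dvd (J : set S) (a : multinom n) i :
  idl J -> J (x i) -> (0 < a i)%N -> J (monomial x a).
Proof.
move=> HJ Ji ai; rewrite /monomial (bigD1 i) //=; apply: idlMr => //.
by rewrite -(prednK ai) exprS; apply: idlMr.
Qed.

Lemma monomial_prime (J : set S) (a : multinom n) : primeI J ->
  J (monomial x a) -> exists2 i, (0 < a i)%N & J (x i).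
Proof.
move=> HJ; have [HI J1 JM] := HJ; rewrite /monomial.
elim/big_rec: _ => [//|i b _ IH /JM[Jx|/IH //]].
exists i; last exact: primeI_exp Jx.
by case: (a i) Jx => // /J1.
Qed.

Lemma monomial_vars (T : seq 'I_n) (a : multinom n) :
  V T (monomial x a) -> exists2 i, i \in T & (0 < a i)%N.
Proof.
have [VT nT] := xprime T; move=> /(monomial_prime VT)[i ai Vi].
by exists i => //; apply: contrapT => /negP /nT.
Qed.

Lemma mulI_vars i a b : x i * a = x i * b -> a = b.
Proof.
move=> e; have [[_ _ h] nx] := xprime [::].
have : V [::] (x i * (a - b)) by rewrite /V /= mulrBr e subrr.
by move=> /h[/(nx i isT)//|/eqP]; rewrite subr_eq0 => /eqP.
Qed.

Lemma mulXI_vars i k a b : x i ^+ k * a = x i ^+ k * b -> a = b.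
Proof.
by elim: k => [|k IH]; rewrite ?mul1r // !exprS -!mulrA => /mulI_vars.
Qed.

Lemma monomial1 k : monomial x (mnm1 k) = x k.
Proof.
rewrite /monomial (bigD1 k) //= big1 ?mulr1; first by rewrite mnm1E eqxx.
by move=> l lk; rewrite mnm1E eq_sym (negPf lk).
Qed.

Lemma monomial2 (i j : 'I_n) (a : multinom n) : i != j ->
  (forall k, k != i -> k != j -> a k = 0%N) -> monomial x a = x i ^+ a i * x j ^+ a j.
Proof.
move=> ij a0; rewrite /monomial (bigD1 i) //= (bigD1 j) 1?eq_sym //=.
by rewrite big1 ?mulr1 // => k /andP[ki kj]; rewrite a0.
Qed.

Lemma mdeg2 (i j : 'I_n) (a : multinom n) : i != j ->
  (forall k, k != i -> k != j -> a k = 0%N) -> mdeg a = (a i + a j)%N.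
Proof.
move=> ij a0; rewrite mdegE (bigD1 i) //= (bigD1 j) 1?eq_sym //=.
by rewrite big1 ?addn0 // => k /andP[ki kj]; rewrite a0.
Qed.

(** Otherwise cancellation leaves x_i^(t+1) = x_j^(t+1), which puts x_i into the prime (x_j). *)
Lemma monomial2_inj (i j : 'I_n) (a b : multinom n) : i != j ->
    (forall k, k != i -> k != j -> a k = 0%N) ->
    (forall k, k != i -> k != j -> b k = 0%N) ->
    mdeg a = mdeg b -> monomial x a = monomial x b -> (a i <= b i)%N.
Proof.
move=> ij a0 b0; rewrite (mdeg2 ij a0) (mdeg2 ij b0) (monomial2 ij a0) (monomial2 ij b0).
move=> e1 e2; rewrite leqNgt; apply/negP => lt.
have [t et] : exists t, (a i = b i + t.+1)%N by exists (a i - b i).-1; lia.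
have et' : (b j = a j + t.+1)%N by lia.
rewrite et et' !exprD -mulrA in e2; move/mulXI_vars: e2.
rewrite mulrC => /mulXI_vars e3.
have [Vj nj] := xprime [:: j]; apply: (nj i); first by rewrite inE.
apply: (primeI_exp (k := t.+1)) => //; rewrite e3 exprS.
by case: Vj => HI _ _; apply: idlMr => //; exact: (@mem_vars [:: j] j (mem_head _ _)).
Qed.

Variables (I : set S) (m : nat) (u : 'I_m -> multinom n) (d : nat).
Hypothesis I_ideal : is_ideal I.
Hypothesis I_gen : I = gen_ideal [set monomial x (u j) | j in [set: 'I_m]].
Hypothesis single_degree : forall j, mdeg (u j) = d.
Hypothesis dim_quotient : krull_dim I 0.

(** Otherwise every generator involves a variable other than x_i, and I lies in the prime of those
    variables. This prime is strictly below [rker rho], which contradicts dim S/I = 0. *)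
Lemma pure_power i : exists p, forall k, k != i -> u p k = 0%N.
Proof.
apply: contrapT => /forallNP H; pose T := [seq k <- enum 'I_n | k != i].
have mT k : (k \in T) = (k != i) by rewrite mem_filter mem_enum andbT.
have [VT nT] := xprime T; have [VI _ _] := VT.
have IT : I `<=` V T.
  rewrite I_gen; apply: gen_ideal_min => // _ [p _ <-].
  have /existsNP[k /not_implyP[ki uk]] := H p.
  apply: (monomial_dvd (i := k)) => //; first by apply: mem_vars; rewrite mT.
  by rewrite lt0n; apply/eqP.
have [_ /(_ 1%N (fun l => if l is 0%N then V T else rker rho))] := dim_quotient.
move=> h; apply: notF; apply: h; split.
  move=> [|[|//]] _; split=> //; try exact/prime_idealP; first exact/prime_idealP/rker_prime.
  apply: (subset_trans IT); apply: addl_min.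
  - by case: (rker_prime rho).
  - by move=> _ ->; rewrite /rker /= rmorph0.
  - by move=> _ /mapP[k _ ->]; apply: rho_x.
move=> [|//] _; split.
  apply: addl_min.
  - by case: (rker_prime rho).
  - by move=> _ ->; rewrite /rker /= rmorph0.
  - by move=> _ /mapP[k _ ->]; apply: rho_x.
by move=> /(_ (x i) (rho_x i)); apply: nT; rewrite mT eqxx.
Qed.

Lemma pure_powerE i p : (forall k, k != i -> u p k = 0%N) -> u p i = d.
Proof.
move=> H; rewrite -(single_degree p) mdegE (bigD1 i) //= big1 ?addn0 //.
Qed.

Hypothesis linear_rel : has_linear_relations x u.

(* The functional keeping only the generators [x_i^c x_j^(d-c)] with [c > a]
   would map every linear relation, but not the relation between [x_i^d] and
   [x_j^d], into the prime ideal generated by the other variables. *)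
Lemma edge_monomial (i j : 'I_n) a : i != j -> (a <= d)%N ->
  exists p, [/\ u p i = a, u p j = (d - a)%N & forall k, k != i -> k != j -> u p k = 0%N].
Proof.
move=> ij ad; apply: contrapT => /forallNP H.
have [p0 hp0] := pure_power i; have [q0 hq0] := pure_power j.
have p0i := pure_powerE hp0; have q0j := pure_powerE hq0.
have p0j : u p0 j = 0%N by apply: hp0; rewrite eq_sym.
have q0i : u q0 i = 0%N by apply: hq0.
have a_lt : (a < d)%N.
  rewrite ltn_neqAle ad andbT; apply/eqP => e; apply: (H p0).
  by rewrite p0i p0j e subnn; split=> // k ki _; apply: hp0.
pose T := [seq k <- enum 'I_n | (k != i) && (k != j)].
have mT k : (k \in T) = (k != i) && (k != j) by rewrite mem_filter mem_enum andbT.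
have [VT nT] := xprime T; have [VI V1 VM] := VT.
pose C p := [forall k, (k \in T) ==> (u p k == 0%N)] && (a < u p i)%N.
have CT p : reflect (forall k, k != i -> k != j -> u p k = 0%N)
                    [forall k, (k \in T) ==> (u p k == 0%N)].
  apply: (iffP forallP) => [h k ki kj|h k].
    by have := h k; rewrite mT ki kj => /eqP.
  by rewrite mT; apply/implyP => /andP[ki kj]; rewrite h.
(* Outside the prime, both sides involve x_i and x_j only. The exponent of x_i is then at least a +
   1 on the left but at most a on the right, because [u q i] differs from [a] by assumption. *)
have key c c' p q : x c * monomial x (u p) = x c' * monomial x (u q) ->
    C p -> ~~ C q -> V T (x c * monomial x (u p)).
  move=> e /andP[/CT tp ap] nCq; apply: contrapT => nV.
  have mon k r : ~ V T (x k * monomial x (u r)) ->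
      forall l, l != i -> l != j -> (mnm_add (mnm1 k) (u r)) l = 0%N.
    move=> h l li lj; apply/eqP; rewrite -leqn0 leqNgt; apply/negP => hl; apply: h.
    rewrite -monomial1 -monomialD.
    by apply: monomial_dvd hl => //; apply: mem_vars; rewrite mT li lj.
  have A0 := mon c p nV; rewrite e in nV; have B0 := mon c' q nV.
  have tq k : k != i -> k != j -> u q k = 0%N.
    by move=> ki kj; have := B0 k ki kj; rewrite mnmDE; lia.
  have uqj := mdeg2 ij tq; rewrite single_degree in uqj.
  have uqi : u q i <> a.
    by move=> uqa; apply: (H q); split=> //; lia.
  have uqa : (u q i <= a)%N.
    by rewrite leqNgt; apply: contra nCq => h; apply/andP; split=> //; apply/CT.
  have := monomial2_inj ij A0 B0; rewrite !mdegD !mdeg1 !single_degree !monomialD !monomial1.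
  by move=> /(_ erefl e); rewrite !mnmDE !mnm1E; lia.
pose L (v : 'rV[S]_m) := \sum_(p | C p) v 0 p * monomial x (u p).
have L_delta c p : L (c *: delta_mx 0 p) = (if C p then c else 0) * monomial x (u p).
  rewrite /L; case: ifP => Cp.
    rewrite (bigD1 p) //= big1 ?addr0; first by rewrite !mxE !eqxx mulr1.
    by move=> q /andP[_ /negPf qp]; rewrite !mxE eqxx qp mulr0 mul0r.
  rewrite mul0r big1 // => q Cq; rewrite !mxE eqxx.
  by case: (q =P p) Cq => [->|_ _]; rewrite ?Cp ?mulr0 ?mul0r.
have LB v w : L (v - w) = L v - L w.
  by rewrite /L -sumrB; apply: eq_bigr => p _; rewrite !mxE mulrBl.
have LV v : gen_submod (linear_relations x u) v -> V T (L v).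
  move=> [s [Hs ->]].
  have -> : L (\sum_(t <- s) t.1 *: t.2) = \sum_(t <- s) t.1 * L t.2.
    rewrite {1}/L; under eq_bigr => p _ do rewrite summxE mulr_suml.
    rewrite exchange_big /=; apply: eq_bigr => t _; rewrite mulr_sumr.
    by apply: eq_bigr => p _; rewrite mxE mulrA.
  rewrite big_seq; apply: idl_sum => // t /Hs [c [c' [p [q [e ->]]]]].
  apply: idlM => //; rewrite LB !L_delta.
  case: ifP => Cp; case: ifP => Cq.
  - by rewrite e subrr; apply: idl0.
  - by rewrite mul0r subr0; apply: (key _ c' _ q) => //; rewrite Cq.
  - rewrite mul0r sub0r; apply: idlN => //.
    by apply: (key _ c _ p) => //; rewrite Cp.
  - by rewrite !mul0r subrr; apply: idl0.
(* The relation between x_i^d and x_j^d is sent to their product, which avoids the variables in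
   [T]. *)
have : V T (L (monomial x (u q0) *: delta_mx 0 p0 - monomial x (u p0) *: delta_mx 0 q0)).
  apply: LV; rewrite -linear_rel /=.
  under eq_bigr do rewrite !mxE mulrBl.
  rewrite sumrB (bigD1 p0) //= big1 ?addr0; last first.
    by move=> p /negPf pp; rewrite pp mulr0 mul0r.
  rewrite (bigD1 q0) //= big1 ?addr0; last first.
    by move=> p /negPf pp; rewrite pp mulr0 mul0r.
  by rewrite !eqxx !mulr1 mulrC subrr.
have Cp0 : C p0 by apply/andP; split; [apply/CT => k ki _; apply: hp0|rewrite p0i].
have Cq0 : C q0 = false by rewrite /C q0i ltn0 andbF.
rewrite LB !L_delta Cp0 Cq0 mul0r subr0 => /VM[] /monomial_vars[k]; rewrite mT => /andP[ki kj].
  by rewrite hq0.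
by rewrite hp0.
Qed.

Lemma degree_gt0 : (0 < n)%N -> (0 < d)%N.
Proof.
move=> n0; rewrite lt0n; apply/eqP => d0; have [p hp] := pure_power (Ordinal n0).
have [HI] := (is_idealP I).1 I_ideal; apply.
have -> : 1 = monomial x (u p).
  rewrite /monomial big1 // => k _; have := single_degree p.
  by rewrite d0 mdegE => /eqP; rewrite sum_nat_eq0 => /forallP/(_ k)/= /eqP ->.
by rewrite I_gen; apply: sub_gen_ideal; exists p.
Qed.

Definition msuppn (w : multinom n) : {set 'I_n} := finset (fun i => 0 < w i)%N.

Lemma large_exponent (w : multinom n) k : (0 < d)%N -> (0 < k)%N ->
  mdeg w = (d * k)%N -> (#|msuppn w| <= k)%N -> exists j, (d <= w j)%N.
Proof.
move=> d0 k0 ew sk; apply: contrapT => /forallNP H.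
have lt j : (w j <= d.-1)%N.
  by have := H j; move/negP; rewrite -ltnNge; lia.
suff : (mdeg w <= d.-1 * k)%N by rewrite ew leq_pmul2r //; lia.
rewrite mdegE (bigID (mem (msuppn w))) /= [X in (_ + X)%N]big1 ?addn0; last first.
  by move=> i; rewrite inE -leqNgt leqn0 => /eqP.
apply: leq_trans (leq_mul (leqnn _) sk).
by rewrite mulnC -sum_nat_const; apply: leq_sum.
Qed.

Lemma small_exponent (w : multinom n) k : (0 < d)%N -> (0 < k)%N ->
  mdeg w = (d * k)%N -> #|msuppn w| = k -> exists2 i, (0 < w i)%N & (w i <= d)%N.
Proof.
move=> d0 k0 ew sk; apply: contrapT => H.
suff : (d.+1 * k <= mdeg w)%N by rewrite ew leq_pmul2r // ltnn.
rewrite mdegE (bigID (mem (msuppn w))) /= -{1}sk mulnC -sum_nat_const.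
apply: leq_trans (leq_addr _ _); apply: leq_sum => i; rewrite inE => wi.
by rewrite ltnNge; apply/negP => h; apply: H; exists i.
Qed.

(* Walker's alias method: empty the smallest heap [w i] into a bin of capacity
   [d], and fill that bin up from a heap of size at least [d]. *)
Lemma alias (w : multinom n) k : (0 < d)%N ->
  mdeg w = (d * k)%N -> (#|msuppn w| <= k)%N ->
  exists f : 'I_k -> 'I_m, monomial x w = \prod_j monomial x (u (f j)).
Proof.
move=> d0; elim: k w => [|k IH] w ew sw.
  exists (fun j : 'I_0 => match j with Ordinal _ lt => False_rect _ (notF (introT idP lt)) end).
  rewrite big_ord0 /monomial big1 // => i _.
  suff -> : w i = 0%N by [].
  apply/eqP; rewrite -leqn0 leqNgt; apply/negP => wi.
  move: sw; rewrite leqn0 cards_eq0 => /eqP/setP/(_ i).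
  by rewrite !inE wi.
(* It suffices to split off a generator that leaves at most [k] variables in the support. *)
suff [p le_p sp] : exists2 p, (forall i, u p i <= w i)%N & (#|msuppn (mnm_sub w (u p))| <= k)%N.
  have wE : w = mnm_add (u p) (mnm_sub w (u p)).
    by apply/mnmP => i; rewrite mnmDE mnmBE subnKC.
  have [|//|f ef] := IH (mnm_sub w (u p)).
    have := congr1 (@mdeg n) wE; rewrite mdegD single_degree ew mulnS => /addnI <-.
    by [].
  exists (fun j => if unlift ord0 j is Some j' then f j' else p).
  rewrite {1}wE monomialD ef big_ord_recl unlift_none; congr (_ * _).
  by apply: eq_bigr => j _; rewrite liftK.
have sub p : msuppn (mnm_sub w (u p)) \subset msuppn w.
  by apply/fintype.subsetP => i; rewrite !inE mnmBE; lia.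
have sub1 p i : (0 < w i)%N -> u p i = w i -> (#|msuppn (mnm_sub w (u p))| <= k)%N.
  move=> wi upi; rewrite -ltnS; apply: leq_trans sw; apply: proper_card.
  rewrite properE sub; apply/fintype.subsetPn; exists i; rewrite !inE //.
  by rewrite mnmBE upi subnn.
have [j dj] := large_exponent d0 (ltn0Sn k) ew sw.
have pure i : (d <= w i)%N -> exists2 p, (forall l, u p l <= w l)%N & u p i = d.
  move=> di; have [p hp] := pure_power i; exists p; last exact: pure_powerE.
  by move=> l; case: (eqVneq l i) => [->|/hp -> //]; rewrite pure_powerE.
(* A small support allows any pure power dividing [w]. Otherwise it has k + 1 elements and one of
   them must be used up. *)
have [sk|sk] := leqP #|msuppn w| k.
  have [p le_p _] := pure j dj; exists p => //.
  exact: leq_trans (subset_leq_card (sub p)) sk.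
have [i wi wd] : exists2 i, (0 < w i)%N & (w i <= d)%N.
  by apply: (@small_exponent w k.+1) => //; apply/eqP; rewrite eqn_leq sw.
have [e|ne] := eqVneq (w i) d.
  have [p le_p upi] := pure i (eq_leq (esym e)).
  by exists p => //; apply: (sub1 p i) => //; rewrite upi e.
have ij : i != j by apply: contra_neq ne => e; subst j; apply/eqP; rewrite eqn_leq wd.
have [p [upi upj up0]] := edge_monomial ij wd; exists p; last exact: sub1 upi.
move=> l; case: (eqVneq l i) => [->|li]; first by rewrite upi.
case: (eqVneq l j) => [->|lj]; last by rewrite up0.
by rewrite upj; apply: leq_trans dj; apply: leq_subr.
Qed.

Lemma ideal_exp_mpow k : (0 < n)%N -> (n <= k)%N -> ideal_exp I k = mpow x (d * k).
Proof.
move=> n0 nk; have d0 := degree_gt0 n0; apply/seteqP; split.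
  apply: gen_ideal_min; first exact: idl_mpow.
  move=> _ [f [If ->]]; have {}If j : mpow x d (f j).
    move: (f j) (If j) => a; rewrite I_gen; move: a.
    apply: gen_ideal_min; first exact: idl_mpow.
    by move=> _ [p _ <-]; rewrite -(single_degree p); apply: mem_mpow.
  elim: k f If {nk} => [|k IH] f If.
    by rewrite muln0 /mpow pw0.
  by rewrite big_ord_recl mulnS; apply: mpowM => //; apply: IH.
apply: mpow_min; first exact: gen_idealD.
move=> w ew; have [|f ->] := @alias w k d0 ew.
  by apply: leq_trans nk; rewrite -[X in (_ <= X)%N]card_ord max_card.
apply: sub_gen_ideal; exists (fun j => monomial x (u (f j))); split=> // j.
by rewrite I_gen; apply: sub_gen_ideal; exists (f j).
Qed.

End MonomialIdeal.

(** * Asymptotics *)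

Section Asymptotics.

(** In factorials, the product of the binomials is (N+n-1)!/(N-1)! divided by (N+i) i! (n-1-i)!. *)
Lemma bin_rising_prod N n i : (0 < N)%N -> (i < n)%N ->
  ('C((N + n).-1, N + i) * 'C((N + i).-1, i) * (i`! * (n.-1 - i)`!) * (N + i) =
   \prod_(l < n) (N + l))%N.
Proof.
case: N => // M _ lt_in.
have prodE k : (\prod_(l < k) (M.+1 + l) * M`! = (M + k)`!)%N.
  elim: k => [|k IH]; first by rewrite big_ord0 mul1n addn0.
  by rewrite big_ord_recr /= mulnAC IH mulnC addnS factS addSn.
have b1 : ('C(M + n, M.+1 + i) * ((M.+1 + i)`! * (n.-1 - i)`!) = (M + n)`!)%N.
  have -> : (n.-1 - i = M + n - (M.+1 + i))%N by lia.
  by apply: bin_fact; lia.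
have b2 : ('C(M + i, i) * (i`! * M`!) = (M + i)`!)%N.
  by rewrite -{2}(addnK i M); apply: bin_fact; lia.
apply/eqP; rewrite -(eqn_pmul2r (fact_gt0 M)) prodE -b1 !addSn /= factS -b2; apply/eqP.
ring.
Qed.

(** Quotient of the rising product identities for [i] and for 0. *)
Lemma bin_ratio N n i : (0 < N)%N -> (i < n)%N ->
  ('C((N + n).-1, N + i) * 'C((N + i).-1, i) * (N + i) =
   'C(n.-1, i) * N * ('C((N + n).-1, N + 0) * 'C((N + 0).-1, 0)))%N.
Proof.
move=> N0 lt_in; have e1 := bin_rising_prod N0 lt_in.
have e2 := bin_rising_prod N0 (leq_trans (ltn0Sn i) lt_in).
have e3 : ('C(n.-1, i) * (i`! * (n.-1 - i)`!) = n.-1`!)%N by apply: bin_fact; lia.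
rewrite -{}e2 fact0 mul1n subn0 -e3 in e1.
have f0 : (0 < i`! * (n.-1 - i)`!)%N by rewrite muln_gt0 !fact_gt0.
apply/eqP; rewrite -(eqn_pmul2r f0); apply/eqP.
transitivity ('C((N + n).-1, N + i) * 'C((N + i).-1, i) * (i`! * (n.-1 - i)`!) * (N + i))%N.
  by ring.
rewrite e1 addn0; ring.
Qed.

(** The rising product at N = d k, as a polynomial in k; omitting the factor l = i accounts for the
    division by N + i. *)
Definition betti_poly (n d i : nat) : {poly rat} :=
  (i`!%:R * (n.-1 - i)`!%:R)^-1 *: \prod_(l < n | l != i :> nat) (d%:R *: 'X + l%:R%:P).

Lemma betti_polyE n d i k : (0 < d * k)%N -> (i < n)%N ->
  (betti_poly n d i).[k%:R] =
  ('C((d * k + n).-1, d * k + i) * 'C((d * k + i).-1, i))%:R.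
Proof.
move=> N0 lt_in; have e := bin_rising_prod N0 lt_in.
rewrite (bigD1 (Ordinal lt_in)) //= mulnC in e.
have /eqP {}e := e; rewrite eqn_pmul2l in e; last by rewrite addn_gt0 N0.
have f0 : (i`! * (n.-1 - i)`!)%:R != 0 :> rat by rewrite pnatr_eq0 -lt0n muln_gt0 !fact_gt0.
rewrite /betti_poly hornerZ horner_prod -natrM; apply: (mulfI f0).
rewrite mulVKf // -natrM mulnC (eqP e) natr_prod; apply: eq_big => [l|l _]; first by [].
by rewrite !hornerE natrD natrM.
Qed.

Lemma betti_poly_lead n d i : (0 < d)%N -> (i < n)%N ->
  size (betti_poly n d i) = n /\
  lead_coef (betti_poly n d i) = d%:R ^+ n.-1 / (i`!%:R * (n.-1 - i)`!%:R).
Proof.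
move=> d0 lt_in; have d1 : d%:R != 0 :> rat by rewrite pnatr_eq0 -lt0n.
have f0 : (i`!%:R * (n.-1 - i)`!%:R : rat) != 0.
  by rewrite mulf_neq0 // pnatr_eq0 -lt0n fact_gt0.
have sz l : size (d%:R *: 'X + (l%:R)%:P : {poly rat}) = 2%N.
  by rewrite -mul_polyC size_MXaddC polyC_eq0 (negPf d1) /= size_polyC d1.
have card : #|[pred l : 'I_n | (l : nat) != i]| = n.-1.
  by rewrite -[in RHS](card_ord n) -(cardC1 (Ordinal lt_in)); apply: eq_card => l; rewrite !inE.
rewrite /betti_poly size_scale ?invr_neq0 // lead_coefZ; split.
  rewrite size_prod; last by move=> l _; rewrite -size_poly_gt0 sz.
  rewrite (eq_bigr (fun=> 2%N)) => [|l _]; last exact: sz.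
  by rewrite sum_nat_const card; lia.
rewrite lead_coef_prod (eq_bigr (fun=> d%:R)) => [|l _].
  by rewrite prodr_const card mulrC.
by rewrite lead_coefE sz coefD coefZ coefX coefC /= mulr1 addr0.
Qed.

Lemma poly_eq_near (P Q : {poly rat}) :
  (\forall k \near \oo, P.[k%:R] = Q.[k%:R]) -> P = Q.
Proof.
move=> [k0 _ H]; apply: contrapT => /eqP; rewrite -subr_eq0 => nz.
(* One more root than the degree of [P - Q] allows. *)
pose rs : seq rat := [seq (k0 + j)%:R | j <- iota 0 (size (P - Q))].
have rr : all (root (P - Q)) rs.
  apply/allP => _ /mapP[j _ ->]; rewrite rootE !hornerE H ?subrr //=.
  exact: leq_addr.
have ur : uniq rs.
  rewrite map_inj_uniq; first exact: iota_uniq.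
  by move=> a b /eqP; rewrite eqr_nat eqn_add2l => /eqP.
by have := max_poly_roots nz rr ur; rewrite size_map size_iota ltnn.
Qed.

Lemma kodiyalam_polyE (S : comNzRingType) (K : fieldType) (rho : {rmorphism S -> K})
    (J : set S) (i : nat) (P : {poly rat}) :
  (\forall k \near \oo, P.[k%:R] = (betti rho i (ideal_exp J k))%:R) ->
  kodiyalam_poly rho J i = P.
Proof.
move=> HP; rewrite /kodiyalam_poly; case: xgetP => [Q -> HQ|/(_ P)//].
by apply: poly_eq_near; apply: filterS2 HQ HP => k -> ->.
Qed.

Lemma cvg_ratio (R : realType) (c d i : nat) : (0 < d)%N ->
  (fun k : nat => c%:R * ((d * k)%:R / (d * k + i)%:R) : R) @ \oo --> (c%:R : R).
Proof.
move=> d0; apply/cvgrPdist_le => e e0; near=> k.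
have k0 : (0 < k)%N by near: k; exists 1%N.
have N0 : (0 : R) < (d * k + i)%:R by rewrite ltr0n addn_gt0 muln_gt0 d0 k0.
have -> : c%:R - c%:R * ((d * k)%:R / (d * k + i)%:R) = (c * i)%:R / (d * k + i)%:R :> R.
  by have := lt0r_neq0 N0; rewrite natrD !natrM => N1; field.
rewrite ger0_norm; last by rewrite divr_ge0 ?ler0n.
rewrite ler_pdivrMr //.
(* As d >= 1, this bound on [k] already makes c i / (d k + i) at most [e]. *)
have : (c * i)%:R / e <= k%:R by near: k; apply: nbhs_infty_ger.
rewrite ler_pdivrMr // mulrC => /le_trans; apply.
by rewrite ler_pM2l // ler_nat; nia.
Unshelve. all: by end_near. Qed.

End Asymptotics.

(** * Leading coefficients and the limit of the ratios *)

Theorem corollary2p8 (R : realType) (S : comNzRingType) (K : fieldType)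
    (n : nat) (x : 'I_n -> S) (rho : {rmorphism S -> K})
    (setting : regular_local x rho \/ polynomial_ring x rho)
    (I : set S) (I_ideal : is_ideal I)
    (m : nat) (u : 'I_m -> multinom n)
    (I_monomial : minimal_monomial_generators x I u)
    (d : nat) (single_degree : forall j, mdeg (u j) = d)
    (dim_quotient : krull_dim I 0)
    (linear_rel : has_linear_relations x u)
    (i : nat) (i_range : (1 <= i <= n)%N) :
  ((fun k : nat => (betti rho i (ideal_exp I k))%:R /
                   (betti rho 1 (ideal_exp I k))%:R : R) @ \oo
     --> (ratr (kodiyalam_coef rho I i / kodiyalam_coef rho I 1) : R)) /\
  kodiyalam_coef rho I i / kodiyalam_coef rho I 1 = 'C(n.-1, i.-1)%:R :> rat.
Proof.
have xprime : prime_vars x.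
  by case: setting => [/regular_local_prime_vars|/polynomial_ring_prime_vars].
have rho_x j : rho (x j) = 0.
  case: setting => [[_ _ _ _ xM]|[f [_ <- ->]]].
    have : rker rho (x j) by rewrite -xM; apply: sub_gen_ideal; exists j.
    by [].
  by rewrite mcoeffX; case: eqP => // e; have := congr1 (@mdeg n) e; rewrite mdeg0 mdeg1.
case: i i_range => // i /= lt_in; have n0 : (0 < n)%N := leq_ltn_trans (leq0n i) lt_in.
have [I_gen _] := I_monomial.
have d0 : (0 < d)%N by apply: (degree_gt0 xprime rho_x I_ideal I_gen single_degree).
have bettiE j k : (n <= k)%N ->
    betti rho j.+1 (ideal_exp I k) =
    ('C((d * k + n).-1, d * k + j) * 'C((d * k + j).-1, j))%N.
  move=> nk; rewrite (ideal_exp_mpow xprime rho_x I_ideal I_gen single_degree) //.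
  by apply: betti_mpow => //; rewrite muln_gt0 d0 (leq_trans n0).
(* All these polynomials have degree n - 1, so the power of d and the factorial (n-1)! are the same
   for every [j] and cancel in the ratio. *)
have coefE j : (j < n)%N -> kodiyalam_coef rho I j.+1 =
    d%:R ^+ n.-1 / (j`!%:R * (n.-1 - j)`!%:R) * n.-1`!%:R.
  move=> jn; have [s l] := betti_poly_lead d0 jn.
  rewrite /kodiyalam_coef (kodiyalam_polyE (P := betti_poly n d j)) ?s ?l //.
  exists n => // k /= nk; rewrite bettiE // betti_polyE //.
  by rewrite muln_gt0 d0 (leq_trans n0).
have ratio : kodiyalam_coef rho I i.+1 / kodiyalam_coef rho I 1 = 'C(n.-1, i)%:R :> rat.
  have e3 : ('C(n.-1, i) * (i`! * (n.-1 - i)`!) = n.-1`!)%N by apply: bin_fact; lia.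
  have nf k : k`!%:R != 0 :> rat by rewrite pnatr_eq0 -lt0n fact_gt0.
  have d1 : d%:R ^+ n.-1 != 0 :> rat by rewrite expf_neq0 // pnatr_eq0 -lt0n.
  rewrite !coefE // fact0 subn0 mul1r divfK //.
  rewrite -[X in _ * X / _](congr1 (GRing.natmul 1) e3) !natrM.
  move: (nf i) (nf (n.-1 - i)%N) => n1 n2; field.
  by rewrite n1 n2 d1.
split=> //; rewrite ratio ratr_nat.
(* For k >= n the ratio is exactly C(n-1, i) d k / (d k + i) by [bin_ratio], with [i] already
   lowered by one. *)
apply: cvg_trans (@cvg_ratio R 'C(n.-1, i) d i d0).
apply: near_eq_cvg; near=> k.
have nk : (n <= k)%N by near: k; exists n.
have N0 : (0 < d * k)%N by rewrite muln_gt0 d0 (leq_trans n0).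
rewrite !bettiE //; have e := bin_ratio N0 lt_in.
set B := ('C(_, _ + i) * _)%N in e *; set B0 := ('C(_, _ + 0) * _)%N in e *.
have B0gt : (0 < B0)%N by rewrite /B0 muln_gt0 !bin_gt0; lia.
have B1 : B0%:R != 0 :> R by rewrite pnatr_eq0 -lt0n.
have N1 : (d * k + i)%:R != 0 :> R by rewrite pnatr_eq0 -lt0n addn_gt0 N0.
apply: (mulIf B1); rewrite divfK //; apply: (mulIf N1).
by rewrite [LHS]mulrAC [_ * (_ / _)]mulrA divfK // -!natrM e.
Unshelve. all: by end_near. Qed.
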